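(* Let $X$ be a real Banach space and let $G$ be a compact topological group acting isometrically on $X$. Let $I=\Phi+\Psi:X\to(-\infty,\infty]$ with $\Phi\in C^1(X,\mathbb{R})$ and $\Psi:X\to(-\infty,\infty]$ convex, lower semicontinuous and $\Psi\not\equiv\infty$. Suppose that $I$ satisfies the Palais-Smale condition, that $\Phi$ and $\Psi$ are $G$-invariant, and that $\Psi$ is compatible with the action of $G$ on $X$. Let $c\in\mathbb{R}$, let $N$ be a neighbourhood of $K_c$, and let $\varepsilon_0>0$. Then there is $\varepsilon\in(0,\varepsilon_0)$ such that, for each compact set $A\subset X\setminus N$ with $$c\le \sup_{u\in A} I(u)\le c+\varepsilon,$$ there exist a closed set $W$ with $A\subset \mathrm{int}(W)$ and a deformation $\alpha_s:W\to X$, $0\le s\le s_0$, with $s_0>0$ sufficiently small, such that: i) $\|\alpha_s(u)-u\|\le s$ for all $u\in W$; ii) there is a sufficiently small number $\delta=\delta_\varepsilon>0$ such that $I(\alpha_s(u))-I(u)\le s+\delta s$ for all $u\in W$, and $I(\alpha_s(u))-I(u)\le -3\varepsilon s+\delta s$ for all $u\in W$ with $I(u)\ge c-\varepsilon$; iii) $I(\alpha_s(u))-I(u)\le 2s$ for all $u\in W$; iv) $I(\alpha_s(u))-I(u)\le -2\varepsilon s$ for all $u\in W$ with $I(u)\ge c-\varepsilon$; v) $\sup_{u\in A}I(\alpha_s(u))-\sup_{u\in A}I(u)\le -2\varepsilon s$; vi) $I(\alpha_s(u))-I(u)\le 0$ for all $u\in W\cap C$, for each closed set $C$ verifying $C\cap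 K=\emptyset$. Moreover, whenever $A$ is a $G$-invariant set, $\alpha_s$ is equivariant in $A$, i.e. $\alpha_s(gu)=g\alpha_s(u)$ for all $u\in A$, $g\in G$.
   Context: A point $u\in X$ is a critical point of $I=\Phi+\Psi$ if $I(u)<\infty$ and $\langle\Phi'(u),v-u\rangle+\Psi(v)-\Psi(u)\ge 0$ for all $v\in X$. $K$ is the set of critical points of $I$ and $K_c:=\{u\in K: I(u)=c\}$. A Palais-Smale sequence for $I$ at level $c$ is a sequence $(u_n)$ with $I(u_n)\to c$ and, for some $\varepsilon_n\to0^+$, $\langle\Phi'(u_n),v-u_n\rangle+\Psi(v)-\Psi(u_n)\ge-\varepsilon_n\|v-u_n\|$ for all $v\in X$. $I$ satisfies the Palais-Smale condition if, for every level $c\in\mathbb{R}$, each Palais-Smale sequence at level $c$ has a convergent subsequence. An action of $G$ on $X$ is a continuous map $G\times X\to X$, $(g,v)\mapsto gv$, with $ev=v$, $(gh)v=g(hv)$, and $v\mapsto gv$ linear for each $g$; it is isometric if $\|gv\|=\|v\|$ for all $g,v$. A set $A\subset X$ is $G$-invariant if $gA=A$ for every $g\in G$; a functional $\varphi$ is $G$-invariant if $\varphi(gx)=\varphi(x)$ for all $x\in X$, $g\in G$. Let $\mu$ be the normalized Haar measure on $G$ ($\mu(G)=1$); integrals of $X$-valued functions are Bochner integrals. $\Psi$ is compatible with the action of $G$ on $X$ if $$\Psi\left(\int_G\beta(gu)\,d\mu\right)\le\int_G\Psi(\beta(gu))\,d\mu$$ for every $u\in X$ and every $\beta\in C(Gu,X)$,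 where $Gu:=\{gu:g\in G\}$. A deformation is a family of mappings $\alpha_s=\alpha(s,\cdot):W\subset X\to X$, $s\in[0,s_0]$, with $\alpha\in C([0,s_0]\times W,X)$ and $\alpha_0=\mathrm{Id}|_W$. *)

(* Defs.v *)
From HB Require Import structures.
From mathcomp Require Import all_boot all_order all_algebra.
From mathcomp Require Import all_classical all_reals all_analysis.

Set Implicit Arguments.
Unset Strict Implicit.
Unset Printing Implicit Defensive.

Import Order.TTheory GRing.Theory Num.Theory.
Import numFieldNormedType.Exports.

Local Open Scope classical_set_scope.
Local Open Scope ring_scope.

(* A topological group is pointed here because measurable types are pointed in
   the library; a group being nonempty, this is no restriction (the point need
   not be the unit). Hausdorffness is not required. *)
HB.mixin Record isTopologicalGroup G & Group G & PointedTopological G := {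
  mulg_continuous : continuous (fun p : G * G => (p.1 * p.2)%g) ;
  invg_continuous : continuous (fun g : G => (g^-1)%g)
}.

#[short(type="topologicalGroupType")]
HB.structure Definition TopologicalGroup :=
  {G of Group G & PointedTopological G & isTopologicalGroup G}.

Definition borel (G : topologicalGroupType) := g_sigma_algebraType (@open G).

(* Left-invariant regular Borel probability measures. On a compact group closed
   sets are compact, and the closedness of [K] below only ensures that [K] is
   Borel when [G] is not Hausdorff. *)
Record normalized_haar (R : realType) (G : topologicalGroupType)
    (mu : probability (borel G) R) : Prop := {
  haar_left_invariant : forall (g : G) (B : set (borel G)), measurable B ->
    mu [set (g * h)%g | h in B] = mu B ;
  haar_outer_regular : forall B : set (borel G), measurable B ->
    mu B = ereal_inf [set mu U | U in [set U : set G | open U /\ B `<=` U]] ;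
  haar_inner_regular : forall U : set G, open U ->
    mu U = ereal_sup
      [set mu K | K in [set K : set G | [/\ compact K, closed K & K `<=` U]]]
}.

Section bochner.
Context {R : realType} {d : measure_display} {T : measurableType d}
  {X : normedModType R}.
Variable mu : probability T R.

Definition simple_function (s : T -> X) : Prop :=
  finite_set (range s) /\ forall x, measurable (s @^-1` [set x]).

Definition simple_integral (s : T -> X) : X :=
  \sum_(x \in range s) fine (mu (s @^-1` [set x])) *: x.

Definition is_bochner_integral (f : T -> X) (y : X) : Prop :=
  exists s : nat -> T -> X,
    [/\ forall n, simple_function (s n),
        {ae mu, forall t, s n t @[n --> \oo] --> f t},
        (\int[mu]_t (`|f t - s n t|)%:E)%E @[n --> \oo] --> 0%E &
        simple_integral (s n) @[n --> \oo] --> y].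

(* [is_bochner_integral f] has at most one solution; the junk value, for
   functions that are not Bochner integrable, is the default point of [X]. *)
Definition bochner_integral (f : T -> X) : X :=
  get [set y | is_bochner_integral f y].

End bochner.

Section functionals.
Context {R : realType} {X : normedModType R}.
Implicit Types (Phi : X -> R) (Psi phi : X -> \bar R).

(* The second clause is the continuity of [x |-> 'd Phi x] for the operator
   norm of the dual of [X]. *)
Definition C1_functional Phi : Prop :=
  (forall x, differentiable Phi x) /\
  forall x (e : R), 0 < e ->
    \forall y \near x, forall v, `|'d Phi y v - 'd Phi x v| <= e * `|v|.

Definition convex_functional Psi : Prop :=
  forall (u v : X) (t : R), 0 <= t <= 1 ->
    (Psi (t *: u + (1 - t) *: v)%R <= t%:E * Psi u + (1 - t)%:E * Psi v)%E.

Definition energy Phi Psi (u : X) : \bar R := ((Phi u)%:E + Psi u)%E.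

Definition critical Phi Psi : set X :=
  [set u | (energy Phi Psi u < +oo)%E /\
    forall v, (0 <= ('d Phi u (v - u))%:E + Psi v - Psi u)%E].

Definition critical_level Phi Psi (c : R) : set X :=
  [set u | critical Phi Psi u /\ energy Phi Psi u = c%:E].

(* The inequality forces [Psi (u n)] to be finite for every [n], since
   [x - +oo = -oo] in [\bar R]. *)
Definition palais_smale_sequence Phi Psi (c : R) (u : nat -> X) : Prop :=
  energy Phi Psi (u n) @[n --> \oo] --> c%:E /\
  exists eps : nat -> R,
    [/\ forall n, 0 < eps n,
        eps n @[n --> \oo] --> 0 &
        forall n v, (- (eps n * `|v - u n|)%:E <=
          ('d Phi (u n) (v - u n))%:E + Psi v - Psi (u n))%E].

Definition palais_smale Phi Psi : Prop :=
  forall (c : R) (u : nat -> X), palais_smale_sequence Phi Psi c u ->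
    exists (k : nat -> nat) (l : X),
      increasing_seq k /\ u (k n) @[n --> \oo] --> l.

End functionals.

Section actions.
Context {R : realType} {X : normedModType R} {G : topologicalGroupType}.
Variable act : G -> X -> X.

Record linear_action : Prop := {
  act_continuous : continuous (fun p : G * X => act p.1 p.2) ;
  act1 : forall v, act 1%g v = v ;
  actM : forall g h v, act (g * h)%g v = act g (act h v) ;
  act_linear : forall g, linear (act g)
}.

Definition isometric : Prop := forall g v, `|act g v| = `|v|.

Definition invariant_set (A : set X) : Prop := forall g, act g @` A = A.

Definition invariant_fun (T : Type) (phi : X -> T) : Prop :=
  forall g x, phi (act g x) = phi x.

Definition orbit_of (u : X) : set X := range (act^~ u).

Definition compatible (mu : probability (borel G) R) (Psi : X -> \bar R) : Prop :=
  forall (u : X) (beta : X -> X), {within orbit_of u, continuous beta} ->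
    (Psi (bochner_integral mu (fun g : borel G => beta (act g u))) <=
       \int[mu]_(g in [set: borel G]) Psi (beta (act g u)))%E.

End actions.

(* Only the values of [alpha] on [`[0, s0] `*` W] are meaningful. *)
Definition deformation (R : realType) (X : normedModType R) (W : set X)
    (s0 : R) (alpha : R -> X -> X) : Prop :=
  {within `[0, s0] `*` W, continuous (fun p : R * X => alpha p.1 p.2)} /\
  forall u, W u -> alpha 0 u = u.

(* Main.v *)
Require Import Defs.
From HB Require Import structures.
From mathcomp Require Import all_boot all_order all_algebra.
From mathcomp Require Import all_classical all_reals all_analysis.
From mathcomp Require Import wochoice finmap ring lra.

(* By the Palais-Smale condition there is [k1 > 0] such that, near points outside
   [N] and at levels in [c - k1, c + k1], some [v] satisfies
   [<Phi'(u), v - u> + Psi v - Psi u < - k1 |v - u|].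

   Since [W] is chosen before [C] in (vi), the energy must not increase at any
   point of [W], critical points excepted. This is achieved by not moving at all
   on the closed set of points of energy at most [c - 2 eps]. Any other point [u]
   near [A] is moved towards a point [V u] chosen with
   - [|V u - u| <= rho] and [|V u - u| <= 2 dist(u, low set)],
   - [<Phi'(u), V u - u> + Psi (V u) - Psi u <= - k |V u - u|], and even
     [<= - k rho] if [I u >= c - eps].
   For given [u] these conditions define a closed convex set. It is nonempty, and
   by lower semicontinuity of [Psi] a well chosen element of it works for all
   nearby points: for levels at most [c - 3/2 eps] one takes a point close to [u]
   in a direction of steep slope; for higher levels, a nearly closest point of
   the low set if that set is close, since then the energy drops by at least
   [eps / 2] over a short distance, and otherwise a point at distance about [rho]
   obtained by compactness of [A]. A continuous selection [V] then exists, and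
   extends by the identity to the low set. When [A] is invariant, [V u] is
   replaced by the Haar average of [g V(g^-1 u)]. The deformation is
   [u + (s / rho) (V u - u)], and convexity of [Psi] together with the small
   oscillation of [Phi'] near [A] turns the slope estimates into energy
   estimates. *)

Set Implicit Arguments.
Unset Strict Implicit.
Unset Printing Implicit Defensive.

Import Order.TTheory GRing.Theory Num.Theory.
Import numFieldNormedType.Exports.

Local Open Scope classical_set_scope.
Local Open Scope ring_scope.

(** * Neighbourhoods, convex sets and finite sums *)

Lemma near_norm (R : realType) (X : normedModType R) (x : X) (P : X -> Prop) :
  (\forall y \near x, P y) <->
  exists2 e : R, 0 < e & forall y, `|y - x| < e -> P y.
Proof.
rewrite nbhs_normP; split => -[e e0 eP]; exists e => // y yx; apply: eP.
  by rewrite /= distrC.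
by rewrite distrC.
Qed.

Definition convex_in (R : realType) (X : normedModType R) (C : set X) :=
  forall (x y : X) (t : R), C x -> C y -> 0 <= t <= 1 ->
    C (t *: x + (1 - t) *: y).

(** Lets a convex combination be built term by term with its total weight carried along,
    normalization being postponed to the end. If the total weight is zero, both weights vanish and
    any point of [C] serves. *)
Lemma convex_cone (R : realType) (X : normedModType R) (C : set X)
    (x y : X) (a b : R) : convex_in C -> C x -> C y -> 0 <= a -> 0 <= b ->
  exists2 z, C z & a *: x + b *: y = (a + b) *: z.
Proof.
move=> Cc Cx Cy a0 b0.
have [ab0|ab0] := eqVneq (a + b) 0.
  have -> : a = 0 by lra.
  have -> : b = 0 by lra.
  by exists x => //; rewrite addr0 !scale0r addr0.
have ab : 0 < a + b by rewrite lt0r ab0 addr_ge0.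
exists ((a / (a + b)) *: x + (1 - a / (a + b)) *: y).
  apply: Cc => //; rewrite divr_ge0 ?(ltW ab)//=.
  by rewrite ler_pdivrMr// mul1r lerDl.
by rewrite scalerDr !scalerA; congr (_ *: _ + _ *: _); field.
Qed.

Lemma fine_sum (R : realType) (I : Type) (r : seq I) (P : pred I)
    (F : I -> \bar R) : (forall i, P i -> F i \is a fin_num) ->
  fine (\sum_(i <- r | P i) F i)%E = \sum_(i <- r | P i) fine (F i).
Proof.
move=> Ffin; rewrite -[RHS]/(fine (_%:E)) -sumEFin; congr fine.
by apply: eq_bigr => i /Ffin /fineK.
Qed.

(** * Sums weighted by the measures of the fibres of a finite partition *)

Section fibre_sums.
Context (R : realType) (d : measure_display) (T : measurableType d)
  (X : normedModType R) (mu : probability T R).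

Definition measurable_fibres (J : finType) (p : T -> J) :=
  forall j, measurable (p @^-1` [set j]).

(** The integral of the simple function [x \o p]. Indexing by labels instead of values allows [x] to
    repeat values, and a common refinement is obtained by pairing labels. *)
Definition fibre_sum (J : finType) (p : T -> J) (x : J -> X) : X :=
  \sum_(j : J) fine (mu (p @^-1` [set j])) *: x j.

(** A fibre of [q \o p] is the disjoint union of the fibres of [p] over the labels that [q]
    identifies. This passes from a partition to a finer one. *)
Lemma fibre_sum_comp (J J' : finType) (p : T -> J) (q : J -> J') (x : J' -> X) :
  measurable_fibres p -> fibre_sum (q \o p) x = fibre_sum p (x \o q).
Proof.
move=> mp; rewrite /fibre_sum [RHS](partition_big q xpredT)//=.
apply: eq_bigr => j' _.
have -> : fine (mu ((q \o p) @^-1` [set j'])) =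
    \sum_(j | q j == j') fine (mu (p @^-1` [set j])).
  have -> : (q \o p) @^-1` [set j'] =
      \bigcup_(j in [set j | q j == j']) (p @^-1` [set j]).
    apply/seteqP; split => [t /= qp|t [j /= /eqP <- /= <-]]//.
    by exists (p t) => //=; apply/eqP.
  rewrite measure_fin_bigcup//; last 2 first.
  - exact: finite_finset.
  - by move=> i j _ _ [t [/= <- <-]].
  rewrite (@fsbigE _ _ _ _ _ [seq j <- enum J | q j == j'])/=; last 3 first.
  - by rewrite filter_uniq// enum_uniq.
  - by move=> j /=; rewrite mem_filter => /andP[].
  - by move=> j /= qj; rewrite mem_filter qj mem_enum.
  rewrite big_filter_cond big_enum_cond/= fine_sum; last first.
    by move=> j _; exact: fin_num_measure.
  by apply: eq_bigl => j; rewrite /= mem_setE andbb.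
by rewrite scaler_suml; apply: eq_bigr => j /eqP ->.
Qed.

Lemma fibre_sumB (J : finType) (p : T -> J) (x y : J -> X) :
  fibre_sum p x - fibre_sum p y = fibre_sum p (fun j => x j - y j).
Proof.
by rewrite -sumrB; apply: eq_bigr => j _; rewrite scalerBr.
Qed.

Lemma fibre_mass (J : finType) (p : T -> J) : measurable_fibres p ->
  \sum_(j : J) fine (mu (p @^-1` [set j])) = 1.
Proof.
move=> mp; rewrite -fine_sum//; last by move=> j _; exact: fin_num_measure.
have := @measure_fin_bigcup _ _ _ mu J [set: J] (fun j => p @^-1` [set j])
  finite_finset.
rewrite (@fsbigE _ _ _ _ _ (enum J))/= ?enum_uniq//; last first.
  by move=> j _; rewrite mem_enum.
rewrite big_enum_cond/=.
rewrite (eq_bigl xpredT)/=; last by move=> j; rewrite in_setT.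
move=> <-//; last by move=> i j _ _ [t [/= <- <-]].
rewrite [X in mu X](_ : _ = [set: T]) ?probability_setT//.
by apply/seteqP; split => // t _; exists (p t).
Qed.

Lemma norm_fibre_sum (J : finType) (p : T -> J) (x : J -> X) (e : R) :
  measurable_fibres p -> (forall t, `|x (p t)| <= e) -> `|fibre_sum p x| <= e.
Proof.
move=> mp xe; rewrite -[e]mul1r -(fibre_mass mp) mulr_suml.
apply: le_trans (ler_norm_sum _ _ _) _; apply: ler_sum => j _.
rewrite normrZ ger0_norm ?fine_ge0//.
(* A label that [p] never takes has weight zero; the bound on [x] is assumed only at the labels
   taken. *)
have [pj|/set0P[t /= <-]] := eqVneq (p @^-1` [set j]) set0.
  by rewrite pj measure0 !mul0r.
by rewrite ler_wpM2l ?fine_ge0.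
Qed.

(** On the common refinement by pairs of labels, the difference becomes a single sum to which
    [norm_fibre_sum] applies. *)
Lemma fibre_sum_dist (J J' : finType) (p : T -> J) (p' : T -> J') (x : J -> X)
    (x' : J' -> X) (e : R) :
  measurable_fibres p -> measurable_fibres p' ->
  (forall t, `|x (p t) - x' (p' t)| <= e) ->
  `|fibre_sum p x - fibre_sum p' x'| <= e.
Proof.
move=> mp mp' xe; pose r t := (p t, p' t).
have mr : measurable_fibres r.
  move=> [j j']; have -> : r @^-1` [set (j, j')] =
      (p @^-1` [set j]) `&` (p' @^-1` [set j']).
    apply/seteqP; split => t /=; first by case=> -> ->.
    by case=> pj pj'; rewrite /r pj pj'.
  exact: measurableI.
rewrite -[p]/(fst \o r) -[p']/(snd \o r) !fibre_sum_comp// fibre_sumB.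
exact: norm_fibre_sum.
Qed.

Lemma fibre_sum_convex (J : finType) (p : T -> J) (x : J -> X) (C : set X) :
  measurable_fibres p -> convex_in C -> (forall j, C (x j)) ->
  C (fibre_sum p x).
Proof.
move=> mp Cc Cx.
have [t] : [set: T] !=set0.
  apply/set0P/eqP => T0; have := probability_setT mu.
  by rewrite T0 measure0 => -[] /eqP; rewrite eq_sym oner_eq0.
move=> _; have Cp := Cx (p t).
suff [z Cz] : exists2 z, C z &
    fibre_sum p x = (\sum_(j : J) fine (mu (p @^-1` [set j]))) *: z.
  by rewrite fibre_mass// scale1r => ->.
(* Induction on the sum: each partial sum is [a *: z] with [a] the nonnegative partial mass and [z]
   in [C]. The empty sum has [a = 0] and takes [z = x (p t)]. *)
suff [//] : 0 <= (\sum_(j : J) fine (mu (p @^-1` [set j]))) /\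
  exists2 z, C z &
    fibre_sum p x = (\sum_(j : J) fine (mu (p @^-1` [set j]))) *: z.
rewrite /fibre_sum.
apply: (@big_ind2 _ _ (fun y a => 0 <= a /\ exists2 z, C z & y = a *: z)).
- by split => //; exists (x (p t)) => //; rewrite scale0r.
- move=> _ a _ b [a0 [z Cz ->]] [b0 [w Cw ->]]; split; first exact: addr_ge0.
  exact: convex_cone.
- by move=> j _; split; [exact: fine_ge0|exists (x j)].
Qed.

End fibre_sums.

(** * Averages over a probability space *)

Section averages.
Context (R : realType) (d : measure_display) (T : measurableType d)
  (X : normedModType R) (mu : probability T R).

(* Uniform approximation by simple functions takes the place of the Bochner
   integral: the functions averaged below are continuous on a compact group.
   The values [x j] are taken in the range of [f], so that the approximate
   averages are convex combinations of values of [f]. *)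
Definition approx_average (f : T -> X) (e : R) (y : X) : Prop :=
  exists (J : finType) (p : T -> J) (x : J -> X),
    [/\ measurable_fibres p, forall j, range f (x j),
        forall t, `|f t - x (p t)| <= e & y = fibre_sum mu p x].

Definition is_average (f : T -> X) (y : X) : Prop :=
  forall e : R, 0 < e -> exists2 z, approx_average f e z & `|y - z| <= e.

(** Approximate averages of the two functions are compared over a common refinement. Uniqueness of
    averages and their continuity in a parameter both rest on this bound. *)
Lemma is_average_dist (f f' : T -> X) (y y' : X) (a : R) :
  (forall t, `|f t - f' t| <= a) -> is_average f y -> is_average f' y' ->
  `|y - y'| <= a.
Proof.
move=> ff' fy fy'; apply/ler_addgt0Pr => e e0.
have e4 : 0 < e / 4 by lra.
have [z [J [p [x [mp _ xp ->]]]] yz] := fy _ e4.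
have [z' [J' [p' [x' [mp' _ xp' ->]]]] yz'] := fy' _ e4.
have zz' : `|fibre_sum mu p x - fibre_sum mu p' x'| <= e / 4 + a + e / 4.
  apply: fibre_sum_dist => // t.
  have -> : x (p t) - x' (p' t) =
      (x (p t) - f t) + (f t - f' t) + (f' t - x' (p' t)).
    by rewrite !addrA subrK subrK.
  apply: le_trans (ler_normD _ _) _; apply: lerD => //.
  by apply: le_trans (ler_normD _ _) _; apply: lerD => //; rewrite distrC.
have -> : y - y' = (y - fibre_sum mu p x) +
    (fibre_sum mu p x - fibre_sum mu p' x') + (fibre_sum mu p' x' - y').
  by rewrite !addrA subrK subrK.
have := ler_normD ((y - fibre_sum mu p x) +
    (fibre_sum mu p x - fibre_sum mu p' x')) (fibre_sum mu p' x' - y').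
have := ler_normD (y - fibre_sum mu p x)
    (fibre_sum mu p x - fibre_sum mu p' x').
rewrite distrC in yz'; lra.
Qed.

Lemma is_average_unique (f : T -> X) (y y' : X) :
  is_average f y -> is_average f y' -> y = y'.
Proof.
move=> fy fy'; apply/eqP; rewrite -subr_eq0 -normr_le0.
by apply: (is_average_dist _ fy fy') => t; rewrite subrr normr0.
Qed.

(** Approximate averages are convex combinations of values of [f], hence lie in [C], and the average
    is a limit of them. *)
Lemma is_average_closed (f : T -> X) (y : X) (C : set X) :
  convex_in C -> closed C -> range f `<=` C -> is_average f y -> C y.
Proof.
move=> Cc Ccl fC fy; apply: Ccl => U /near_norm[e e0 eU].
have e2 : 0 < e / 2 by lra.
have [z [J [p [x [mp xf _ ->]]]] yz] := fy _ e2.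
exists (fibre_sum mu p x); split.
  by apply: fibre_sum_convex => // j; exact: fC.
by apply: eU; rewrite distrC; lra.
Qed.

Lemma is_average_isometry (f : T -> X) (y : X) (L : {linear X -> X}) :
  (forall x, `|L x| = `|x|) -> is_average f y -> is_average (L \o f) (L y).
Proof.
move=> Liso fy e e0; have [z [J [p [x [mp xf fx ->]]]] yz] := fy _ e0.
exists (L (fibre_sum mu p x)); last by rewrite -raddfB Liso.
exists J, p, (L \o x); split => //.
- by move=> j /=; have [t _ <-] := xf j; exists t.
- by move=> t /=; rewrite -raddfB Liso.
- by rewrite /fibre_sum linear_sum; apply: eq_bigr => j _; rewrite linearZ_LR.
Qed.

(** The labelling is composed with [tau], which preserves the weights. Surjectivity keeps the sample
    values [x j] in the range of [f \o tau]. *)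
Lemma is_average_preserving (f : T -> X) (y : X) (tau : T -> T) :
  (forall t, exists s, tau s = t) ->
  (forall B, measurable B -> measurable (tau @^-1` B)) ->
  (forall B, measurable B -> mu (tau @^-1` B) = mu B) ->
  is_average f y -> is_average (f \o tau) y.
Proof.
move=> taus mtau mutau fy e e0.
have [z [J [p [x [mp xf fx ->]]]] yz] := fy _ e0.
exists (fibre_sum mu p x) => //; exists J, (p \o tau), x; split => //.
- by move=> j; rewrite comp_preimage; exact: mtau.
- by move=> j; have [t _ <-] := xf j; have [s <-] := taus t; exists s.
- by move=> t /=.
- by apply: eq_bigr => j _; rewrite comp_preimage mutau.
Qed.

End averages.

(** Approximate averages of accuracy [n.+1%:R^-1] form a Cauchy sequence, again by comparison over
    common refinements; completeness gives the limit. *)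
Lemma is_average_ex (R : realType) (d : measure_display) (T : measurableType d)
    (X : completeNormedModType R) (mu : probability T R) (f : T -> X) :
  (forall e : R, 0 < e -> exists y, approx_average mu f e y) ->
  exists y, is_average mu f y.
Proof.
move=> fe.
have /choice[y yP] (n : nat) : exists y, approx_average mu f (n.+1%:R^-1) y.
  by apply: fe.
have yd n m : `|y n - y m| <= n.+1%:R^-1 + m.+1%:R^-1.
  have [J [p [x [mp _ xp ->]]]] := yP n.
  have [J' [p' [x' [mp' _ xp' ->]]]] := yP m.
  apply: fibre_sum_dist => // t.
  have -> : x (p t) - x' (p' t) = (x (p t) - f t) + (f t - x' (p' t)).
    by rewrite !addrA subrK.
  by apply: le_trans (ler_normD _ _) _; apply: lerD => //; rewrite distrC.
have : cvg (y @ \oo).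
  apply/cauchy_cvgP/cauchy_ballP => e e0.
  have e2 : 0 < e / 2 by lra.
  have [N _ NP] := near_infty_natSinv_lt (PosNum e2).
  pose tail := [set y n | n in [set n | (N <= n)%N]].
  exists (tail, tail) => [|[_ _] [[n /= Nn <-] [m /= Nm <-]]].
    by split; exists N => // n Nn; exists n.
  rewrite -ball_normE /=.
  apply: le_lt_trans (yd n m) _; rewrite (splitr e).
  exact: ltrD (NP _ Nn) (NP _ Nm).
move=> /cvg_ex[l yl]; exists l => e e0.
have /cvgrPdist_le/(_ e e0) yle := yl.
have [n [yln ne]] : exists n, `|l - y n| <= e /\ n.+1%:R^-1 < e.
  have [N _ NP] : \forall n \near \oo, `|l - y n| <= e /\ n.+1%:R^-1 < e.
    near=> n; split; first by near: n.
    by near: n; exact: (near_infty_natSinv_lt (PosNum e0)).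
  by exists N; apply: NP => /=.
exists (y n) => //; have [J [p [x [mp xf xp yn]]]] := yP n.
by exists J, p, x; split => // t; apply: le_trans (xp t) (ltW ne).
Unshelve. all: by end_near. Qed.

(** * Averages of continuous functions on a compact group *)

Lemma borel_open (G : topologicalGroupType) (U : set G) :
  open U -> measurable (U : set (borel G)).
Proof. exact: sub_sigma_algebra. Qed.

Lemma borel_preimage (G : topologicalGroupType) (tau : G -> G) :
  continuous tau -> forall B : set (borel G), measurable B ->
  measurable (tau @^-1` B : set (borel G)).
Proof.
move=> ctau B; move: B; apply: smallest_sub.
  split => /=.
  - by rewrite preimage_set0; exact: measurable0.
  - by move=> A mA; rewrite setTD -preimage_setC; exact: measurableC.
  - by move=> A mA; rewrite preimage_bigcup; exact: bigcupT_measurable.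
by move=> U oU; apply: borel_open; exact: open_comp.
Qed.

Lemma approx_average_continuous (R : realType) (G : topologicalGroupType)
    (X : normedModType R) (mu : probability (borel G) R) (f : G -> X) (e : R) :
  compact [set: G] -> continuous f -> 0 < e ->
  exists y, approx_average mu (f : borel G -> X) e y.
Proof.
move=> Gc fc e0.
pose U (g : G) := [set t | `|f t - f g| < e].
have oU g : open (U g).
  rewrite openE => t /= Ut; have := fc t => /cvgrPdist_lt.
  move=> /(_ (e - `|f t - f g|)); rewrite subr_gt0 => /(_ Ut).
  apply: filterS => s ts; rewrite /U /=.
  have -> : f s - f g = (f s - f t) + (f t - f g) by rewrite addrA subrK.
  by have := ler_normD (f s - f t) (f t - f g); rewrite (distrC (f s)); lra.
have := Gc; rewrite compact_cover => /(_ G setT U (fun g _ => oU g)).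
case=> [t _|D _ DU]; first by exists t => //; rewrite /U /= subrr normr0.
pose n := size (enum_fset D).
pose c (i : 'I_n) := nth point (enum_fset D) i.
have Uc t : exists i, U (c i) t.
  have [g gD Ut] := DU t I.
  have gn : (index g (enum_fset D) < n)%N by rewrite index_mem.
  by exists (Ordinal gn); rewrite /c /= nth_index.
(* The label of [t] records which sets of the finite cover contain [t], and [x] evaluates [f] at the
   centre of one of these. The all-false label is never taken; its value at [point] is a default. *)
pose p (t : borel G) : {ffun 'I_n -> bool} := [ffun i => `[< U (c i) t >]].
pose x (s : {ffun 'I_n -> bool}) : X :=
  if [pick i | s i] is Some i then f (c i) else f point.
exists (fibre_sum mu p x), {ffun 'I_n -> bool}, p, x; split => //.
- move=> s; have -> : p @^-1` [set s] =
     \bigcap_(i in [set: 'I_n]) (if s i then U (c i) else ~` U (c i)).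
    apply/seteqP; split => [t /= <- i _|t tU].
      by rewrite ffunE; case: asboolP.
    apply/ffunP => i; have := tU i I; rewrite ffunE.
    by case: (s i) => [?|?]; [exact/asboolP|exact/asboolPn].
  apply: fin_bigcap_measurable => // i _.
  case: (s i); first exact: borel_open.
  by apply: measurableC; exact: borel_open.
- by move=> s; rewrite /x; case: pickP => [i _|_]; [exists (c i)|exists point].
- move=> t; rewrite /x; case: pickP => [i|pt].
    by rewrite ffunE => /asboolP/ltW.
  by have [i /asboolP] := Uc t; have := pt i; rewrite ffunE => ->.
Qed.

Section group_average.
Context (R : realType) (X : completeNormedModType R)
  (G : topologicalGroupType) (mu : probability (borel G) R).
Hypothesis Gc : compact [set: G].

Lemma average_ex (f : G -> X) : continuous f ->
  exists y, is_average mu (f : borel G -> X) y.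
Proof.
by move=> fc; apply: is_average_ex => e e0; exact: approx_average_continuous.
Qed.

(** Left translation by [h] is a surjective Borel map, and preimages under it are left translates by
    [h^-1], of the same Haar measure. *)
Lemma average_left_invariant (f : G -> X) (y : X) (h : G) :
  normalized_haar mu ->
  is_average mu (f : borel G -> X) y ->
  is_average mu ((fun g => f (h * g)%g) : borel G -> X) y.
Proof.
move=> muH; have hc k : continuous (fun g : G => (k * g)%g).
  move=> g; apply: (@continuous_comp _ _ _ (fun g : G => (k, g))
    (fun p : G * G => (p.1 * p.2)%g)); last exact: mulg_continuous.
  by apply: cvg_pair => /=; [exact: cvg_cst|exact: cvg_id].
apply: (@is_average_preserving _ _ (borel G) X mu f y (fun g => (h * g)%g)).
- by move=> t; exists (h^-1 * t)%g; rewrite mulVKg.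
- exact: borel_preimage.
- move=> B mB; rewrite -[RHS](haar_left_invariant muH h^-1%g mB).
  congr (mu _); apply/seteqP; split => [g /= Bg|g /= [k Bk <-]].
    by exists (h * g)%g => //; rewrite mulKg.
  by rewrite mulVKg.
Qed.

End group_average.

Lemma near_eq_continuous (T U : topologicalType) (f g : T -> U) (x : T) :
  (\forall y \near x, f y = g y) -> {for x, continuous f} ->
  {for x, continuous g}.
Proof.
move=> fg fx; rewrite /prop_for /continuous_at -(nbhs_singleton fg).
exact: cvg_trans (near_eq_cvg fg) fx.
Qed.

(** * Continuous selections *)

Section selection.
Context (R : realType) (X Z : normedModType R).

(** The points within [d] of some point of [E] and those at least [3/2 d] away from all of [E] are
    uniformly separated by [d / 2], so a Urysohn function exists. *)
Lemma distance_bump (E : set X) (d : R) : 0 < d ->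
  exists phi : X -> R, [/\ continuous phi, forall u, 0 <= phi u <= 1,
    forall u x, E x -> `|u - x| <= d -> phi u = 1 &
    forall u, (forall x, E x -> d + d / 2 <= `|u - x|) -> phi u = 0].
Proof.
move=> d0.
pose A := [set u | forall x, E x -> d + d / 2 <= `|u - x|].
pose B := [set u | exists2 x, E x & `|u - x| <= d].
have AB : uniform_separator A B.
  apply: uniform_separatorW.
  have d2 : 0 < d / 2 by lra.
  exists [set xy : X * X | ball xy.1 (d / 2) xy.2].
    exact: (entourage_ball X (PosNum d2)).
  apply/seteqP; split => // -[u v] /= [[Au [x Ex vx]]].
  rewrite -ball_normE /= => uv; have := Au x Ex.
  have {}uv : `|u - v| < d / 2 := uv.
  have := ler_normD (u - v) (v - x); rewrite addrA subrK.
  move: (`|u - x|) (`|u - v|) (`|v - x|) uv vx => ? ? ?; lra.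
exists (Urysohn A B : X -> R); split.
- exact: Urysohn_continuous.
- move=> u; have := @Urysohn_range X R A B (Urysohn A B u).
  by rewrite /= in_itv /=; apply; exists u.
- move=> u x Ex ux; have := @Urysohn_sub1 X R A B AB (Urysohn A B u); apply.
  by exists u => //; exists x.
- move=> u Au; have := @Urysohn_sub0 X R A B AB (Urysohn A B u); apply.
  by exists u.
Qed.

(* Browder's selection theorem, by Stone's argument: well-order the points of
   [X], let [m x] be the least [y] whose ball contains [x], and let [E n] be the
   set of those [x] that lie at depth [4 / n.+1] in the ball of [m x]. Points of
   [E n] closer than [4 / n.+1] have the same [m], so near [E n] there is only
   one value to select; hence countably many bumps [phi n] suffice, and the
   remainders [r n = \prod_(i < n) (1 - phi i)] vanish locally from some index
   on, which makes the combination finite. *)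
Lemma convex_selection (Y : set X) (F : X -> set Z) :
  (forall y, Y y -> convex_in (F y)) ->
  (forall y, Y y -> exists v, \forall z \near y, Y z /\ F z v) ->
  exists V : X -> Z, forall y, Y y -> F y (V y) /\ {for y, continuous V}.
Proof.
move=> Fc Floc.
have /choice[vr vrP] (y : X) : exists vr : Z * R, Y y ->
    0 < vr.2 /\ forall z, `|z - y| < vr.2 -> Y z /\ F z vr.1.
  have [Yy|] := pselect (Y y); last by exists (0, 0).
  by have [v /near_norm[e e0 ev]] := Floc _ Yy; exists (v, e).
pose v y := (vr y).1; pose rho y := (vr y).2.
pose C y x := Y y /\ `|x - y| < rho y.
have [le wo] := well_ordering_principle X.
(* Antisymmetry is recovered from the uniqueness of least elements in singletons and pairs. *)
have le_anti a b : le a b -> le b a -> a = b.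
  move=> ab ba; have refl c : le c c.
    have [|z [[/eqP -> /(_ c)]]] := wo (pred1 c); first by exists c; rewrite inE.
    by rewrite inE => /(_ (eqxx _)).
  have [|z [_ zu]] := wo (pred2 a b); first by exists a; rewrite !inE eqxx.
  rewrite -(zu a) ?(zu b)//; split; rewrite ?inE ?eqxx ?orbT//.
    by move=> x; rewrite !inE => /orP[] /eqP ->.
  by move=> x; rewrite !inE => /orP[] /eqP ->.
have /choice[m mP] (x : X) : exists y, Y x ->
    C y x /\ forall y', C y' x -> le y y'.
  have [Yx|] := pselect (Y x); last by exists x.
  have [|y [[Cy yle] _]] := wo [pred y | `[< C y x >]].
    exists x; rewrite inE; apply/asboolP; split => //.
    by rewrite subrr normr0; have [] := vrP _ Yx.
  exists y => _; split; first by move: Cy; rewrite inE => /asboolP.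
  by move=> y' Cy'; apply: yle; rewrite inE; exact/asboolP.
pose d (n : nat) : R := n.+1%:R^-1.
have d0 n : 0 < d n by rewrite invr_gt0.
pose E n : set X := [set x | Y x /\ forall z, `|z - x| < 4 * d n -> C (m x) z].
have Em n x x' : E n x -> E n x' -> `|x - x'| < 4 * d n -> m x = m x'.
  move=> [Yx Ex] [Yx' Ex'] xx'; apply: le_anti.
    by apply: (mP _ Yx).2; exact: Ex'.
  by apply: (mP _ Yx').2; apply: Ex; rewrite distrC.
(* Two points of [E n] within [2 * d n] of [u] are less than [4 * d n] apart, so the value does not
   depend on the one picked by [get]. *)
pose w n u := v (m (get [set x | E n x /\ `|u - x| < 2 * d n])).
have wE n x u : E n x -> `|u - x| < 2 * d n -> w n u = v (m x).
  move=> Ex ux; have [] : [set y | E n y /\ `|u - y| < 2 * d n]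
    (get [set y | E n y /\ `|u - y| < 2 * d n]) by apply: getPex; exists x.
  rewrite /w; move: (get _) => y Ey uy; congr v; apply: (Em n) => //.
  have := ler_normD (y - u) (u - x); rewrite addrA subrK (distrC y u).
  by move: (`|y - x|) (`|u - x|) (`|u - y|) (d n) ux uy => *; lra.
have /choice[phi phiP] (n : nat) := distance_bump (E n) (d0 n).
have phi_pos n u : phi n u != 0 ->
    exists x, [/\ E n x, `|u - x| < 2 * d n & F u (w n u)].
  move=> pu; have [x [Ex ux]] : exists x, E n x /\ `|u - x| < 2 * d n.
    apply: contrapT => nx; move/eqP: pu; apply; have [_ _ _] := phiP n; apply.
    move=> x Ex; rewrite leNgt; apply/negP => ux; apply: nx; exists x; split=> //.
    by apply: lt_trans ux _; have := d0 n; lra.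
  exists x; split => //; rewrite (wE n x)//.
  have [Yx /(_ u)] := Ex; case; first by have := d0 n; lra.
  by move=> Ymx umx; have [_ /(_ u umx)[]] := vrP _ Ymx.
(* Within [2 * d n] of a point of [E n] the function [w n] is locally constant; at any other point
   [phi n] vanishes on a ball of radius [d n / 2]. *)
have phiw n : continuous (fun u => phi n u *: w n u).
  move=> u; have [phic _ _ phi0] := phiP n.
  have [[x [Ex ux]]|nx] := pselect (exists x, E n x /\ `|u - x| < 2 * d n).
    apply: (@near_eq_continuous _ _ (fun u => phi n u *: v (m x))).
      apply/near_norm; exists (2 * d n - `|u - x|); first by rewrite subr_gt0.
      move=> u' u'u; rewrite (wE n x)//.
      have := ler_normD (u' - u) (u - x); rewrite addrA subrK; lra.
    by apply: cvgZ; [exact: phic|exact: cvg_cst].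
  apply: (@near_eq_continuous _ _ (fun u => 0 : Z)); last exact: cvg_cst.
  apply/near_norm; exists (d n / 2); first by have := d0 n; lra.
  move=> u' u'u; rewrite phi0 ?scale0r// => x Ex.
  have ux : 2 * d n <= `|u - x|.
    by rewrite leNgt; apply/negP => ?; apply: nx; exists x.
  have := ler_normD (u - u') (u' - x); rewrite addrA subrK (distrC u u').
  by move: (`|u' - x|) (`|u - x|) (`|u' - u|) (d n) ux u'u => *; lra.
(* [r n] is the weight still to be distributed, and [V n] the combination of the values selected so
   far, of total weight [1 - r n]. *)
pose fix r n u {struct n} : R := if n is n.+1 then r n u * (1 - phi n u) else 1.
pose fix V n u {struct n} : Z :=
  if n is n.+1 then V n u + r n u *: (phi n u *: w n u) else 0.
have rc n : continuous (r n).
  elim: n => [|n IH] u /=; first exact: cvg_cst.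
  apply: cvgM; first exact: IH.
  by apply: cvgB; [exact: cvg_cst|have [+ _ _ _] := phiP n; apply].
have Vc n : continuous (V n).
  elim: n => [|n IH] u /=; first exact: cvg_cst.
  apply: cvgD; first exact: IH.
  by apply: cvgZ; [exact: rc|exact: phiw].
have r01 n u : 0 <= r n u <= 1.
  elim: n => [|n /andP[r0 r1]] /=; first by rewrite ler01 lexx.
  have [_ /(_ u)/andP[p0 p1] _ _] := phiP n.
  by rewrite mulr_ge0 ?subr_ge0//= mulr_ile1// ?subr_ge0// gerBl.
have VF n u : Y u -> exists2 z, F u z & V n u = (1 - r n u) *: z.
  move=> Yu; elim: n => [|n [z Fz Vz]] /=.
    have [z /nbhs_singleton[_ Fz]] := Floc _ Yu.
    by exists z => //; rewrite subrr scale0r.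
  have [p0|pn0] := eqVneq (phi n u) 0.
    by exists z; rewrite // p0 subr0 mulr1 scale0r scaler0 addr0.
  have [x [_ _ Fw]] := phi_pos _ _ pn0.
  have /andP[r0 r1] := r01 n u.
  have [_ /(_ u)/andP[q0 q1] _ _] := phiP n.
  have [] := @convex_cone _ _ (F u) z (w n u) (1 - r n u) (r n u * phi n u)
    (Fc _ Yu) Fz Fw; [by rewrite subr_ge0|exact: mulr_ge0|].
  move=> z' Fz' zz'; exists z' => //; rewrite Vz scalerA zz'.
  by congr (_ *: _); ring.
have stat n k u : r n u = 0 -> r (n + k)%N u = 0 /\ V (n + k)%N u = V n u.
  move=> rn0; elim: k => [|k [rk Vk]]; first by rewrite addn0.
  by rewrite addnS /= rk Vk mul0r scale0r addr0.
have stat2 n n' u : r n u = 0 -> r n' u = 0 -> V n u = V n' u.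
  move=> rn rn'; have [_ <-] := stat n n' u rn.
  by rewrite addnC; have [_ ->] := stat n' n u rn'.
(* Any index at which the remainder vanishes may be picked, since [stat2] makes the value
   independent of it. *)
exists (fun u => V (get [set n | r n u = 0]) u) => u Yu.
have getE n u' : r n u' = 0 -> V (get [set n | r n u' = 0]) u' = V n u'.
  move=> rn; apply: stat2 => //.
  by apply: (@getPex _ [set n | r n u' = 0]); exists n.
have [n nE] : exists n, E n u.
  have [[Ymu mu] _] := mP _ Yu.
  (* The depth of [u] in the ball of [m u] is [4 * e], so [u] lies in [E n] once [d n < e]. *)
  pose e := (rho (m u) - `|u - m u|) / 4.
  have e0 : 0 < e by rewrite /e divr_gt0// subr_gt0.
  have [n _ /(_ n (leqnn _)) ne] := near_infty_natSinv_lt (PosNum e0).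
  exists n; split => // z zu; split => //.
  have := ler_normD (z - u) (u - m u); rewrite addrA subrK.
  have {}ne : d n < e by [].
  move: ne zu; rewrite /e.
  by move: (`|z - m u|) (`|z - u|) (`|u - m u|) (d n) (rho _) => *; lra.
have rnear : \forall u' \near u, r n.+1 u' = 0.
  apply/near_norm; exists (d n) => // u' u'u /=.
  have [_ _ phi1 _] := phiP n.
  by rewrite (phi1 u' u)// ?ltW// subrr mulr0.
split.
  have ru := nbhs_singleton rnear; rewrite (getE _ _ ru).
  by have [z Fz ->] := VF n.+1 u Yu; rewrite ru subr0 scale1r.
apply: (@near_eq_continuous _ _ (V n.+1)); last exact: Vc.
by apply: filterS rnear => u' ru' /=; rewrite (getE n.+1).
Qed.

End selection.

(** A real number strictly between [l] and [Psi x] eventually separates [f] from [Psi \o g]. The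
    general filter covers sequences, neighbourhoods, and pairs of a point and a radius. *)
Lemma lsc_near (R : realType) (X : topologicalType) (Psi : X -> \bar R)
    (T : Type) (F : set_system T) (FF : Filter F) (f : T -> R) (g : T -> X)
    (l : R) (x : X) :
  lower_semicontinuous Psi -> f @ F --> l -> g @ F --> x ->
  (l%:E < Psi x)%E -> \forall t \near F, ((f t)%:E < Psi (g t))%E.
Proof.
move=> Pl fl gx lx.
have [b lb bx] : exists2 b : R, l < b & (b%:E < Psi x)%E.
  case: (Psi x) lx => [r| |]//.
    rewrite lte_fin => lr; exists ((l + r) / 2); rewrite ?lte_fin; lra.
  by exists (l + 1); rewrite ?ltry// ltrDl.
have [V xV VP] := Pl _ _ bx.
have fb : \forall t \near F, f t < b by apply: (cvgr_lt l).
have gV : \forall t \near F, V (g t) by exact: gx.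
near=> t; apply: (@lt_trans _ _ b%:E); first by rewrite lte_fin; near: t.
by apply: VP; near: t.
Unshelve. all: by end_near. Qed.

(** * Descent directions *)

Section C1.
Context (R : realType) (X : normedModType R) (Phi : X -> R).
Hypothesis PhiC1 : C1_functional Phi.

Lemma C1_continuous : continuous Phi.
Proof. by move=> x; apply: differentiable_continuous; exact: PhiC1.1. Qed.

Lemma diff_functional_continuous x : continuous ('d Phi x : X -> R).
Proof. exact: (diff_continuous (PhiC1.1 x)). Qed.

(** Operator norm continuity absorbs the change of base point, because the directions are eventually
    bounded by [|y| + 1]; continuity of ['d Phi x] absorbs the change of direction. *)
Lemma C1_diff_cvg (T : Type) (F : set_system T) (FF : Filter F)
    (g h : T -> X) (x y : X) : g @ F --> x -> h @ F --> y ->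
  'd Phi (g t) (h t) @[t --> F] --> ('d Phi x y : R).
Proof.
move=> gx hy; apply/cvgrPdist_lt => e e0.
pose k : R := e / 2 / (`|y| + 1).
have y1 : 0 < `|y| + 1 by have := normr_ge0 y; lra.
have k0 : 0 < k by rewrite !divr_gt0.
have dx := gx _ (PhiC1.2 x _ k0).
have hx : 'd Phi x (h t) @[t --> F] --> ('d Phi x y : R).
  by apply: continuous_cvg => //; exact: diff_functional_continuous.
have e2 : 0 < e / 2 by lra.
have hx2 : \forall t \near F, `|'d Phi x y - 'd Phi x (h t)| < e / 2.
  by move/cvgrPdist_lt: hx; exact.
have hn : \forall t \near F, `|h t| < `|y| + 1.
  apply: (cvgr_lt `|y|); last by rewrite ltrDl.
  exact: cvg_norm.
near=> t.
have A : `|'d Phi (g t) (h t) - 'd Phi x (h t)| <= k * `|h t|.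
  have : forall v, `|'d Phi (g t) v - 'd Phi x v| <= k * `|v| by near: t.
  exact.
have B : k * `|h t| < e / 2.
  have -> : e / 2 = k * (`|y| + 1) by rewrite /k divfK// gt_eqF.
  by rewrite ltr_pM2l//; near: t.
have D : `|'d Phi x y - 'd Phi x (h t)| < e / 2 by near: t.
have := ler_normD ('d Phi x y - 'd Phi x (h t))
  ('d Phi x (h t) - 'd Phi (g t) (h t)).
rewrite addrA subrK (distrC ('d Phi x (h t)) ('d Phi (g t) (h t))).
lra.
Unshelve. all: by end_near. Qed.

(** By the mean value theorem along the segment, the increment is the derivative at an intermediate
    point applied to [h]. *)
Lemma mean_value_bound (u h : X) (b : R) :
  (forall t, 0 <= t <= 1 -> forall v,
     `|'d Phi (u + t *: h) v - 'd Phi u v| <= b * `|v|) ->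
  `|Phi (u + h) - Phi u - 'd Phi u h| <= b * `|h|.
Proof.
move=> ub; pose g (t : R) := Phi (u + t *: h).
have gd (t : R) : is_derive t 1 g ('d Phi (u + t *: h) h).
  have lin : is_diff t (fun s : R => u + s *: h) (fun s : R => s *: h).
    apply: is_diff_eq.
    by apply/funext => s /=; rewrite fctE add0r.
  have dg : differentiable g t.
    apply: (@differentiable_comp _ _ _ _ (fun s : R => u + s *: h) Phi) => //.
    exact: PhiC1.1.
  apply: DeriveDef; first exact: diff_derivable.
  rewrite deriveE// (@diff_comp _ _ _ _ (fun s : R => u + s *: h) Phi)//=.
    by rewrite diff_val scale1r.
  exact: PhiC1.1.
have [|c c01] := @MVT_segment R g (fun t => 'd Phi (u + t *: h) h) 0 1 ler01 _.
  apply: continuous_subspaceT => t; apply: differentiable_continuous.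
  by apply/derivable1_diffP; apply: ex_derive.
move: c01; rewrite in_itv /= => c01.
rewrite /g scale1r scale0r addr0 subr0 mulr1 => ->.
exact: ub.
Qed.

(** Chain rule for [Phi \o L = Phi], a continuous linear map being its own differential. *)
Lemma diff_invariant (L : {linear X -> X}) (u v : X) : continuous L ->
  (forall x, Phi (L x) = Phi x) -> 'd Phi (L u) (L v) = 'd Phi u v.
Proof.
move=> Lc PL.
have -> : 'd Phi u = 'd (Phi \o L) u.
  by congr ('d _ _); apply/funext => x /=.
have dL : differentiable L u by exact: linear_differentiable.
by rewrite (diff_comp dL (PhiC1.1 _)) /= diff_lin.
Qed.

End C1.

(** * A uniform slope from the Palais-Smale condition *)

Lemma increasing_seq_cvg (k : nat -> nat) : increasing_seq k -> k @ \oo --> \oo.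
Proof.
move=> /increasing_seqP ki; have nk n : (n <= k n)%N.
  by elim: n => // n IH; apply: leq_ltn_trans IH (ki n).
by move=> A [N _ NA]; exists N => // n /= Nn; apply: NA; apply: leq_trans (nk n).
Qed.

(** By contradiction: failure for every [k = n.+1%:R^-1] gives a Palais-Smale sequence at level [c]
    approaching the complement of [N]. The limit of a subsequence is critical at level [c], hence
    interior to [N], although points outside [N] converge to it. *)
Lemma palais_smale_slope (R : realType) (X : normedModType R) (Phi : X -> R)
    (Psi : X -> \bar R) (c : R) (N : set X) :
  C1_functional Phi -> (forall u, (-oo < Psi u)%E) ->
  lower_semicontinuous Psi ->
  palais_smale Phi Psi -> critical_level Phi Psi c `<=` N° ->
  exists2 k : R, 0 < k & forall u a, ~ N a -> `|u - a| < k ->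
    ((c - k)%:E <= energy Phi Psi u)%E -> (energy Phi Psi u <= (c + k)%:E)%E ->
    exists v, ((k * `|v - u| + 'd Phi u (v - u))%:E + Psi v < Psi u)%E.
Proof.
move=> PhiC1 PsiNy Psilsc PS KN.
pose h (n : nat) : R := n.+1%:R^-1.
have h0 n : 0 < h n by rewrite invr_gt0.
apply: contrapT => nk.
have /choice[ua uaP] (n : nat) : exists ua : X * X, [/\ ~ N ua.2,
    `|ua.1 - ua.2| < h n,
    ((c - h n)%:E <= energy Phi Psi ua.1)%E,
    (energy Phi Psi ua.1 <= (c + h n)%:E)%E &
    forall v, (Psi ua.1 <=
      (h n * `|v - ua.1| + 'd Phi (ua.1) (v - ua.1))%:E + Psi v)%E].
  apply: contrapT => nex; apply: nk; exists (h n) => // u a Na ua cI Ic.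
  apply: contrapT => nv; apply: nex; exists (u, a); split => // v /=.
  by rewrite leNgt; apply/negP => vlt; apply: nv; exists v.
pose u n := (ua n).1; pose a n := (ua n).2.
have ufin n : Psi (u n) \is a fin_num.
  have [_ _ _ + _] := uaP n; rewrite /energy -/(u n); have := PsiNy (u n).
  by case: (Psi (u n)).
pose i n := Phi (u n) + fine (Psi (u n)).
have iE n : energy Phi Psi (u n) = (i n)%:E by rewrite /energy -(fineK (ufin n)).
have h_cvg : h @ \oo --> (0 : R) := cvg_harmonic.
have ic : i @ \oo --> c.
  apply/cvgrPdist_le => /= e e0; near=> n.
  have [_ _ + + _] := uaP n; rewrite -/(u n) iE !lee_fin => ci ic.
  have he : h n < e by near: n; exact: (near_infty_natSinv_lt (PosNum e0)).
  by rewrite ler_norml; apply/andP; split; lra.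
have [|k [l [kinc ul]]] := PS c u.
  split.
    rewrite (_ : (fun n => _) = EFin \o i); last exact/funext.
    by apply: cvg_EFin => //; exact: nearW.
  exists h; split => // n v.
  have [_ _ _ _ /(_ v)] := uaP n; rewrite -/(u n) -(fineK (ufin n)).
  have := PsiNy v; case: (Psi v) => // [r|] _; rewrite ?leey//=.
  by rewrite -!EFinD !lee_fin; lra.
have kc := increasing_seq_cvg kinc.
have Phik : Phi (u (k n)) @[n --> \oo] --> Phi l.
  exact: (continuous_cvg _ (C1_continuous PhiC1 (x:=l)) ul).
(* [q] is the limit of [Psi] along the subsequence. The limit inequality at [v = l] gives
   [q <= Psi l], and lower semicontinuity the converse. *)
pose q := c - Phi l.
have pq : fine (Psi (u (k n))) @[n --> \oo] --> q.
  rewrite (_ : (fun n => _) = (fun n => i (k n) - Phi (u (k n)))).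
    by apply: cvgB => //; apply: cvg_comp kc ic.
  by apply/funext => n; rewrite /i addrAC subrr add0r.
have Psiv v : (q%:E <= ('d Phi l (v - l))%:E + Psi v)%E.
  have := PsiNy v; have := fun n => let: And5 _ _ _ _ h := uaP n in h v.
  case: (Psi v) => [r| |]//; last by rewrite addey// leey.
  move=> uv _; rewrite -EFinD lee_fin.
  have vu : v - u (k n) @[n --> \oo] --> v - l.
    by apply: cvgB => //; exact: cvg_cst.
  apply: (ler_cvg_to pq (g := fun n => h (k n) * `|v - u (k n)| +
    'd Phi (u (k n)) (v - u (k n)) + r)).
    rewrite -[X in X + r]add0r -[X in X + _ + r](mul0r `|v - l|).
    apply: cvgD; last exact: cvg_cst.
    apply: cvgD; last exact: C1_diff_cvg.
    by apply: cvgM; [exact: cvg_comp kc h_cvg|exact: cvg_norm].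
  by near=> n; have := uv (k n); rewrite -/(u _) -(fineK (ufin _)) -EFinD lee_fin.
have Psil : Psi l = q%:E.
  apply/eqP; rewrite eq_le; apply/andP; split; last first.
    by have := Psiv l; rewrite subrr linear0 add0e.
  rewrite leNgt; apply/negP => ql.
  have [n _ /(_ n (leqnn n))] := lsc_near _ Psilsc pq ul ql.
  by rewrite fineK// ltxx.
have /KN : critical_level Phi Psi c l.
  have Il : energy Phi Psi l = c%:E by rewrite /energy Psil -EFinD addrC subrK.
  split=> //; split; first by rewrite Il ltry.
  move=> v; have := Psiv v; rewrite Psil; have := PsiNy v.
  case: (Psi v) => [r| |]//= _; rewrite ?addey ?addye ?leey//.
  by rewrite -!EFinD !lee_fin; lra.
have al : a (k n) @[n --> \oo] --> l.
  have -> : l = l - 0 by rewrite subr0.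
  rewrite (_ : (fun n => _) = (fun n => u (k n) - (u (k n) - a (k n)))).
    apply: cvgB => //; apply/cvgr0Pnorm_le => /= e e0; near=> n.
    have [_ ua_lt _ _ _] := uaP (k n); apply: le_trans (ltW ua_lt) _.
    near: n; apply: (kc [set m | h m <= e]).
    by apply: filterS (near_infty_natSinv_lt (PosNum e0)) => m /ltW.
  by apply/funext => n; rewrite opprB addrC subrK.
move=> /al; case=> n _ /(_ n (leqnn n)) /= Na.
by have [] := uaP (k n).
Unshelve. all: by end_near. Qed.

(** * Convexity and closedness of the set of descent targets *)

Section descent.
Context (R : realType) (X : normedModType R) (Phi : X -> R) (Psi : X -> \bar R).
Hypothesis PhiC1 : C1_functional Phi.
Hypothesis PsiNy : forall u, (-oo < Psi u)%E.
Hypothesis Psi_convex : convex_functional Psi.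
Hypothesis Psi_lsc : lower_semicontinuous Psi.

(** The bound [b] is an extended real because it will be [Psi u], which may be infinite. *)
Lemma convex_sublevel (h : X -> R) (b : \bar R) :
  (forall (x y : X) (t : R), 0 <= t <= 1 ->
    h (t *: x + (1 - t) *: y) <= t * h x + (1 - t) * h y) ->
  convex_in [set v | ((h v)%:E + Psi v <= b)%E].
Proof.
move=> hc x y t /= hx hy t01.
have := Psi_convex x y t01; have := hc x y t t01.
move: (_ *: x + _) => z; move: hx hy.
have := PsiNy x; have := PsiNy y; have := PsiNy z.
case: b => [b| |]; last 2 first.
- by move=> *; rewrite leey.
- by case: (Psi x).
case: (Psi x) => [p| |]//; case: (Psi y) => [q| |]// => zN _ _.
rewrite -!EFinD !lee_fin => hp hq hz Pz.
have {zN} [r rE] : exists r, Psi z = r%:E.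
  by move: zN Pz; case: (Psi z) => // r; exists r.
move: Pz; rewrite rE -EFinD !lee_fin => Pz.
have /andP[t0 t1] := t01.
have A : t * (h x + p) <= t * b by rewrite ler_wpM2l.
have B : (1 - t) * (h y + q) <= (1 - t) * b by rewrite ler_wpM2l ?subr_ge0.
by lra.
Qed.

Lemma closed_sublevel (h : X -> R) (b : \bar R) : continuous h ->
  closed [set v | ((h v)%:E + Psi v <= b)%E].
Proof.
move=> hc; rewrite -openC openE => v /= /negP; rewrite -ltNge => bv.
have : \forall z \near v, (b < (h z)%:E + Psi z)%E.
  case: b bv => [b| |] bv; last 2 first.
  - by move: bv; rewrite ltNge leey.
  - near=> z; have := PsiNy z; case: (Psi z) => [r| |]// _.
    by rewrite ltNyr.
  have bh : (fun z => b - h z) @ v --> b - h v.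
    by apply: cvgB; [exact: cvg_cst|exact: hc].
  have : ((b - h v)%:E < Psi v)%E by rewrite EFinB lteBlDl.
  move/(lsc_near _ Psi_lsc bh cvg_id); apply: filterS => z.
  by rewrite EFinB lteBlDl.
by apply: filterS => z; rewrite ltNge => /negP.
Unshelve. all: by end_near. Qed.

Variables (c eps k rho : R).

Definition low_level : set X :=
  [set w | (energy Phi Psi w <= (c - 2 * eps)%:E)%E].

(* The bound by [2 * `|w - u|] makes a selection extend continuously by the
   identity to the low level set, where no point needs to move. *)
Definition descent (u : X) : set X := [set v | [/\ `|v - u| <= rho,
  forall w, low_level w -> `|v - u| <= 2 * `|w - u|,
  ((k * `|v - u| + 'd Phi u (v - u))%:E + Psi v <= Psi u)%E &
  ((c - eps)%:E <= energy Phi Psi u)%E ->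
    ((k * rho + 'd Phi u (v - u))%:E + Psi v <= Psi u)%E]].

Lemma norm_convex (u x y : X) (t : R) : 0 <= t <= 1 ->
  `|t *: x + (1 - t) *: y - u| <= t * `|x - u| + (1 - t) * `|y - u|.
Proof.
move=> /andP[t0 t1].
have -> : t *: x + (1 - t) *: y - u = t *: (x - u) + (1 - t) *: (y - u).
  by rewrite !scalerBr addrACA -opprD -scalerDl subrKC scale1r.
by apply: le_trans (ler_normD _ _) _; rewrite !normrZ !ger0_norm ?subr_ge0.
Qed.

Lemma convex_ball (u : X) (b : R) : convex_in [set v | `|v - u| <= b].
Proof.
move=> x y t /= xb yb t01; apply: le_trans (norm_convex _ _ _ t01) _.
have /andP[t0 t1] := t01.
have A : t * `|x - u| <= t * b by rewrite ler_wpM2l.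
have B : (1 - t) * `|y - u| <= (1 - t) * b by rewrite ler_wpM2l ?subr_ge0.
by lra.
Qed.

Lemma diff_convex (u x y : X) (t : R) :
  'd Phi u (t *: x + (1 - t) *: y - u) =
  t * 'd Phi u (x - u) + (1 - t) * 'd Phi u (y - u).
Proof.
have -> : t *: x + (1 - t) *: y - u = t *: (x - u) + (1 - t) *: (y - u).
  by rewrite !scalerBr addrACA -opprD -scalerDl subrKC scale1r.
by rewrite linearD !linearZ.
Qed.

Lemma descent_convex (u : X) : 0 <= k -> convex_in (descent u).
Proof.
move=> k0 x y t [x1 x2 x3 x4] [y1 y2 y3 y4] t01; split.
- exact: (@convex_ball u rho x y t).
- by move=> w lw; exact: (@convex_ball u (2 * `|w - u|) x y t (x2 w lw) (y2 w lw)).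
- apply: (@convex_sublevel (fun v => k * `|v - u| + 'd Phi u (v - u)) (Psi u)
    _ x y t) => // x' y' t' t01'.
  rewrite diff_convex; have := norm_convex u x' y' t01'.
  by move=> /(ler_wpM2l k0); lra.
- move=> Iu.
  apply: (@convex_sublevel (fun v => k * rho + 'd Phi u (v - u)) (Psi u)
    _ x y t (x4 Iu) (y4 Iu)) => // x' y' t' t01'.
  by rewrite diff_convex; lra.
Qed.

Lemma norm_sub_continuous (u : X) : continuous (fun v : X => `|v - u|).
Proof.
by move=> v; apply: cvg_norm; apply: cvgB; [exact: cvg_id|exact: cvg_cst].
Qed.

Lemma diff_sub_continuous (u : X) : continuous (fun v : X => 'd Phi u (v - u)).
Proof.
move=> v; apply: continuous_cvg; first exact: diff_functional_continuous.
by apply: cvgB; [exact: cvg_id|exact: cvg_cst].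
Qed.

Lemma closed_norm_ball (u : X) (b : R) : closed [set v : X | `|v - u| <= b].
Proof.
rewrite (_ : mkset _ = (fun v : X => `|v - u|) @^-1` [set x | x <= b])//.
by apply: closed_comp; [move=> v _; exact: norm_sub_continuous|exact: closed_le].
Qed.

Lemma descent_closed (u : X) : closed (descent u).
Proof.
(* The conditional clause becomes an intersection indexed by [{u}] or by the empty set. *)
have -> : descent u = [set v | `|v - u| <= rho] `&`
    (\bigcap_(w in low_level) [set v | `|v - u| <= 2 * `|w - u|]) `&`
    [set v | ((k * `|v - u| + 'd Phi u (v - u))%:E + Psi v <= Psi u)%E] `&`
    (\bigcap_(w in [set w | w = u /\ ((c - eps)%:E <= energy Phi Psi u)%E])
       [set v | ((k * rho + 'd Phi u (v - u))%:E + Psi v <= Psi u)%E]).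
  apply/seteqP; split => [v [v1 v2 v3 v4]|v [[[v1 v2] v3] v4]].
    by do 3?split => //; move=> w [_ /v4].
  by split => // Iu; exact: (v4 u).
apply: closedI; [apply: closedI; [apply: closedI|]|].
- exact: closed_norm_ball.
- by apply: closed_bigI => w _; exact: closed_norm_ball.
- apply: closed_sublevel => v; apply: cvgD; last exact: diff_sub_continuous.
  by apply: cvgM; [exact: cvg_cst|exact: norm_sub_continuous].
- apply: closed_bigI => w _; apply: closed_sublevel => v.
  by apply: cvgD; [exact: cvg_cst|exact: diff_sub_continuous].
Qed.

(** The energy is lower semicontinuous, so the low level set is closed. *)
Lemma low_far (u : X) : ~ low_level u ->
  exists2 e : R, 0 < e & forall w, low_level w -> e <= `|w - u|.
Proof.
move=> /negP; rewrite -ltNge => uL.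
have Pc : (fun z => c - 2 * eps - Phi z) @ u --> c - 2 * eps - Phi u.
  by apply: cvgB; [exact: cvg_cst|exact: C1_continuous].
have : ((c - 2 * eps - Phi u)%:E < Psi u)%E by rewrite EFinB lteBlDl.
move/(lsc_near _ Psi_lsc Pc cvg_id)/near_norm => [e e0 eP].
exists e => // w lw; rewrite leNgt; apply/negP => /eP.
by rewrite EFinB lteBlDl// ltNge => /negP; apply.
Qed.

(** On the segment from [u] to [v] the norm and the differential scale by [t], and [Psi] lies below
    its chord; the strict inequality is thus multiplied by [t]. *)
Lemma scale_slope (u v : X) (b t : R) :
  0 < t <= 1 -> (Psi u < +oo)%E -> 0 <= b ->
  ((b * `|v - u| + 'd Phi u (v - u))%:E + Psi v < Psi u)%E ->
  exists v', `|v' - u| = t * `|v - u| /\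
  ((b * `|v' - u| + 'd Phi u (v' - u))%:E + Psi v' < Psi u)%E.
Proof.
move=> /andP[t0 t1] Pu b0 uv; exists (t *: v + (1 - t) *: u).
have E : t *: v + (1 - t) *: u - u = t *: (v - u).
  by rewrite scalerBl scale1r scalerBr addrA addrAC addrK.
rewrite E normrZ gtr0_norm//; split => //.
have := Psi_convex v u (t := t); rewrite (ltW t0) t1 => /(_ isT).
rewrite linearZ/=; move: (_ + _ *: u) => z; have := PsiNy z; move: uv Pu.
have := PsiNy v; have := PsiNy u.
case: (Psi u) => [q| |]//; case: (Psi v) => [p| |]// _ _.
rewrite -EFinD lte_fin => vu _ zN Pz.
have {zN} [r rE] : exists r, Psi z = r%:E.
  by move: zN Pz; case: (Psi z) => // r; exists r.
move: Pz; rewrite rE -EFinD lee_fin lte_fin => Pz.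
have : t * (b * `|v - u| + 'd Phi u (v - u) + p) < t * q by rewrite ltr_pM2l.
by rewrite /GRing.scale/=; lra.
Qed.

(** The distance may not be attained, but it is positive, so some point is within half of it from
    optimal. The factor [3 / 2] stays below the [2] in [descent], which leaves room to perturb
    [u]. *)
Lemma almost_nearest (S : set X) (u : X) (e : R) : 0 < e -> S !=set0 ->
  (forall w, S w -> e <= `|w - u|) ->
  exists2 w, S w & forall w', S w' -> `|w - u| <= 3 / 2 * `|w' - u|.
Proof.
move=> e0 [w0 Sw0] Se; pose D := [set `|w - u| | w in S].
have Dlb : lbound D e by move=> _ [w Sw <-]; exact: Se.
have Dinf : has_inf D by split; [exists `|w0 - u|, w0|exists e].
have De : e <= inf D by apply: lb_le_inf => //; exists `|w0 - u|, w0.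
have D2 : 0 < inf D / 2 by lra.
have [_ [w Sw <-] wD] := inf_adherent D2 Dinf; exists w => // w' Sw'.
have : inf D <= `|w' - u| by apply: ge_inf; [exists e|exists w'].
by move: (inf D) (`|w - u|) (`|w' - u|) wD De => x y z; lra.
Qed.

End descent.

(** * Energy decrease, and targets valid on a neighbourhood *)

Section descent_field.
Context (R : realType) (X : normedModType R) (Phi : X -> R) (Psi : X -> \bar R).
Hypothesis PhiC1 : C1_functional Phi.
Hypothesis PsiNy : forall u, (-oo < Psi u)%E.
Hypothesis Psi_convex : convex_functional Psi.
Hypothesis Psi_lsc : lower_semicontinuous Psi.
Variables (c eps k rho : R).
Hypothesis eps0 : 0 < eps.
Hypothesis k0 : 0 < k.
Hypothesis rho0 : 0 < rho.
Hypothesis k_rho : 4 * (k * rho) <= eps.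

Let I := energy Phi Psi.
Let lo := low_level Phi Psi c eps.
Let D := descent Phi Psi c eps k rho.

Definition small_oscillation (u : X) : Prop :=
  forall x, `|x - u| <= rho -> forall w,
    `|'d Phi x w - 'd Phi u w| <= k / 4 * `|w|.

(** [Phi] follows its linearization up to [k / 4] times the displacement and [Psi] lies below its
    chord, so three quarters of the slope gained in [descent] survive. *)
Lemma descent_energy (u v : X) (t : R) :
  small_oscillation u -> D u v -> 0 <= t <= 1 ->
  (I (u + t *: (v - u))%R <= I u)%E /\
  (((c - eps)%:E <= I u)%E ->
    (I (u + t *: (v - u))%R <= I u - (3 / 4 * t * (k * rho))%:E)%E).
Proof.
move=> osc [v1 _ v3 v4] t01; have /andP[t0 t1] := t01.
have mv : Phi (u + t *: (v - u)) <=
    Phi u + t * 'd Phi u (v - u) + k / 4 * (t * `|v - u|).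
  have := @mean_value_bound _ _ _ PhiC1 u (t *: (v - u)) (k / 4).
  have -> : 'd Phi u (t *: (v - u)) = t * 'd Phi u (v - u) by rewrite linearZ.
  rewrite normrZ ger0_norm// => mvb.
  suff /mvb : forall s, 0 <= s <= 1 -> forall w,
      `|'d Phi (u + s *: (t *: (v - u))) w - 'd Phi u w| <= k / 4 * `|w|.
    by rewrite ler_norml => /andP[_]; lra.
  move=> s /andP[s0 s1]; apply: osc; rewrite addrAC subrr add0r !normrZ.
  rewrite !ger0_norm// mulrA; apply: le_trans v1.
  by rewrite ler_piMl// mulr_ile1.
have uE : u + t *: (v - u) = t *: v + (1 - t) *: u.
  by rewrite scalerBl scale1r scalerBr addrC addrA addrAC.
have := Psi_convex v u t01; rewrite -uE.
move: mv v1 v3 v4; rewrite /I /energy; move: (u + t *: (v - u)) => z.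
have := PsiNy z; have := PsiNy v; have := PsiNy u.
case: (Psi u) => [q| |]// _; last by rewrite !addey ?leey.
case: (Psi v) => [p| |]// _ zN mv v1.
rewrite -!EFinD !lee_fin => v3 v4 Pz.
have {zN} [r rE] : exists r, Psi z = r%:E.
  by move: zN Pz; case: (Psi z) => // r; exists r.
move: Pz; rewrite rE lee_fin => Pz.
have n0 : 0 <= k * (t * `|v - u|) by rewrite !mulr_ge0// ltW.
have A : t * (k * `|v - u| + 'd Phi u (v - u) + p) <= t * q.
  by rewrite ler_wpM2l.
split; first by rewrite -EFinD lee_fin; lra.
move=> /v4 {}v4; rewrite -EFinD lee_fin.
have B : t * (k * rho + 'd Phi u (v - u) + p) <= t * q by rewrite ler_wpM2l.
have C : k * (t * `|v - u|) <= k * (t * rho) by rewrite !ler_wpM2l// ltW.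
by lra.
Qed.

(** Strict versions of the conditions in [descent] at [u] persist nearby, by continuity of ['d Phi]
    and lower semicontinuity of [Psi]. *)
Lemma descent_near (u v : X) : ~ lo u -> `|v - u| < rho ->
  (forall w, lo w -> `|v - u| <= 3 / 2 * `|w - u|) ->
  ((k * `|v - u| + 'd Phi u (v - u))%:E + Psi v < Psi u)%E ->
  (I u <= (c - 3 / 2 * eps)%:E)%E \/
    ((k * rho + 'd Phi u (v - u))%:E + Psi v < Psi u)%E ->
  \forall z \near u, D z v.
Proof.
move=> loNu vrho vlo v3 v4.
have [p pE] : exists p, Psi v = p%:E.
  have := PsiNy v; move: v3; case: (Psi v) => [p| |]//; first by exists p.
  by rewrite addey// ltNge leey.
rewrite pE -EFinD in v3.
have vz : v - z @[z --> u] --> v - u.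
  by apply: cvgB; [exact: cvg_cst|exact: cvg_id].
have dz : 'd Phi z (v - z) @[z --> u] --> ('d Phi u (v - u) : R).
  exact: C1_diff_cvg.
have N1 : \forall z \near u, `|v - z| < rho.
  by apply: (cvgr_lt _ (cvg_norm vz)).
have N2 : \forall z \near u, forall w, lo w -> `|v - z| <= 2 * `|w - z|.
  have [e e0 eP] := low_far PhiC1 Psi_lsc loNu.
  (* Moving [u] by less than [e / 8] costs at most [5/16 e], while half of [|w - z|] is at least
     [7/16 e]. *)
  apply/near_norm; exists (e / 8) => [|z zu w lw]; first lra.
  have := eP _ lw; have := vlo _ lw.
  have := ler_normD (v - u) (u - z); have := ler_normD (w - z) (z - u).
  rewrite !addrA !subrK (distrC u z).
  by move: (`|v - z|) (`|w - z|) (`|v - u|) (`|w - u|) (`|z - u|) zu => *; lra.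
have N3 : \forall z \near u,
    ((k * `|v - z| + 'd Phi z (v - z))%:E + Psi v <= Psi z)%E.
  have fz : k * `|v - z| + 'd Phi z (v - z) + p @[z --> u] -->
      k * `|v - u| + 'd Phi u (v - u) + p.
    apply: cvgD; last exact: cvg_cst.
    by apply: cvgD => //; apply: cvgM; [exact: cvg_cst|exact: cvg_norm].
  apply: filterS (lsc_near _ Psi_lsc fz cvg_id v3) => z.
  by rewrite pE -EFinD => /ltW.
have fz : k * rho + 'd Phi z (v - z) + p @[z --> u] -->
    k * rho + 'd Phi u (v - u) + p.
  by apply: cvgD; [apply: cvgD => //|]; exact: cvg_cst.
have N4 : \forall z \near u, ((c - eps)%:E <= I z)%E ->
    ((k * rho + 'd Phi z (v - z))%:E + Psi v <= Psi z)%E.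
  case: v4 => [Iu|v4]; last first.
    rewrite pE -EFinD in v4.
    apply: filterS (lsc_near _ Psi_lsc fz cvg_id v4) => z.
    by rewrite pE -EFinD => /ltW.
  have gz : p + k * rho + Phi z + 'd Phi z (v - z) @[z --> u] -->
      p + k * rho + Phi u + 'd Phi u (v - u).
    by apply: cvgD => //; apply: cvgD; [exact: cvg_cst|exact: C1_continuous].
  (* A nearby [z] may have energy at least [c - eps] although [I u] does not. The gap of [eps / 2]
     between the two levels then pays for [k * rho], which is at most [eps / 4]. *)
  have gu : p + k * rho + Phi u + 'd Phi u (v - u) < c - eps.
    have n0 : 0 <= k * `|v - u| by rewrite mulr_ge0// ltW.
    move: v3 Iu; rewrite /I /energy; have := PsiNy u.
    case: (Psi u) => [q| |]// _; rewrite -!EFinD ?lee_fin ?lte_fin.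
    have := k_rho; have := eps0; move: n0.
    move: (k * `|v - u|) ('d Phi u _) (k * rho) (Phi u) => a b d f.
    by lra.
  apply: filterS (cvgr_lt _ gz _ gu) => z zlt.
  rewrite /I /energy pE; have := PsiNy z; move: zlt; move: ('d Phi z _) => d.
  case: (Psi z) => [q| |]// zlt _; last by move=> _; rewrite leey.
  by rewrite -!EFinD !lee_fin; lra.
near=> z; split; first by apply/ltW; near: z.
- by near: z.
- by near: z.
- by near: z.
Unshelve. all: by end_near. Qed.

Lemma descent_exists (u : X) : ~ lo u -> small_oscillation u ->
  (((c - 3 / 2 * eps)%:E < I u)%E -> exists2 v, `|v - u| < rho &
     ((k * rho + 'd Phi u (v - u))%:E + Psi v < Psi u)%E) ->
  ((I u <= (c - 3 / 2 * eps)%:E)%E -> exists v,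
     ((2 * k * `|v - u| + 'd Phi u (v - u))%:E + Psi v < Psi u)%E) ->
  exists v, \forall z \near u, D z v.
Proof.
move=> loNu osc high midl.
have [e e0 eP] := low_far PhiC1 Psi_lsc loNu.
have weaken v : `|v - u| <= rho ->
    ((k * rho + 'd Phi u (v - u))%:E + Psi v < Psi u)%E ->
    ((k * `|v - u| + 'd Phi u (v - u))%:E + Psi v < Psi u)%E.
  move=> vr; apply: le_lt_trans; apply: leeD => //; rewrite lee_fin.
  by rewrite lerD2r ler_wpM2l// ltW.
have [Iu|Iu] := leP (I u) (c - 3 / 2 * eps)%:E.
  have [v v2] := midl Iu.
  pose m := Num.min rho e.
  have m0 : 0 < m by rewrite lt_min rho0.
  have [mrho me] : m <= rho /\ m <= e by split; rewrite ge_min lexx ?orbT.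
  (* This [t] brings the target within [m] of [u] without distinguishing cases on [|v - u|]. *)
  pose t := m / (m + `|v - u|).
  have mn : 0 < m + `|v - u| by have := normr_ge0 (v - u); lra.
  have t01 : 0 < t <= 1.
    by rewrite divr_gt0//= ler_pdivrMr// mul1r lerDl.
  have Pu : (Psi u < +oo)%E.
    by move: Iu; rewrite /I /energy; case: (Psi u) => [q| |]//; rewrite ltry.
  have [|v' [v't v'2]] :=
      @scale_slope _ _ _ _ PsiNy Psi_convex u v (2 * k) t t01 Pu _ v2.
    by rewrite mulr_ge0// ltW.
  have v'm : `|v' - u| < m.
    rewrite v't /t mulrAC ltr_pdivrMr// ltr_pM2l// ltrDr//.
  exists v'; apply: descent_near => //.
  - exact: lt_le_trans v'm mrho.
  - move=> w /eP ew; apply: le_trans (ltW v'm) _.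
    by have := normr_ge0 (w - u); lra.
  - apply: le_lt_trans v'2; apply: leeD => //; rewrite lee_fin lerD2r.
    by rewrite -mulrA ler_peMl ?ler1n// mulr_ge0// ltW.
  - by left.
have [v vrho v2] := high Iu.
have [vlo|nvlo] := pselect (forall w, lo w -> `|v - u| <= 3 / 2 * `|w - u|).
  by exists v; apply: descent_near => //; [apply: weaken => //; exact: ltW|right].
have [w [lw wv]] : exists w, lo w /\ `|w - u| * (3 / 2) < `|v - u|.
  apply: contrapT => nw; apply: nvlo => w lw; rewrite leNgt; apply/negP => wv.
  by apply: nw; exists w; split => //; rewrite mulrC.
have [|w' low' w'P] := almost_nearest e0 _ eP; first by exists w.
have w'rho : `|w' - u| < rho.
  apply: le_lt_trans (w'P _ lw) _; rewrite mulrC.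
  exact: lt_trans wv vrho.
(* From [u] to [w'] the energy drops by more than [eps / 2], whereas [k * rho] and the linearization
   error total at most [5/4 k rho], that is [5/16 eps]. *)
have w'2 : ((k * rho + 'd Phi u (w' - u))%:E + Psi w' < Psi u)%E.
  have := @mean_value_bound _ _ _ PhiC1 u (w' - u) (k / 4).
  rewrite subrKC => mvb.
  have /mvb : forall s, 0 <= s <= 1 -> forall h,
      `|'d Phi (u + s *: (w' - u)) h - 'd Phi u h| <= k / 4 * `|h|.
    move=> s /andP[s0 s1]; apply: osc; rewrite addrAC subrr add0r normrZ.
    by rewrite ger0_norm//; apply: le_trans (ltW w'rho); rewrite ler_piMl.
  rewrite ler_norml => /andP[mv _].
  have n0 : k * `|w' - u| <= k * rho by rewrite ler_wpM2l// ltW.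
  have k1 : 0 < k * rho by rewrite mulr_gt0.
  move: low' Iu; rewrite /lo /low_level /I /energy /=.
  have := PsiNy w'; have := PsiNy u.
  case: (Psi w') => [p| |]//; case: (Psi u) => [q| |]// _ _.
    rewrite -!EFinD !lee_fin !lte_fin.
    by have := k_rho; have := eps0; move: mv; move: ('d Phi u _) => d; lra.
  by move=> _ _; rewrite -EFinD ltry.
exists w'; apply: descent_near => //; last by right.
by apply: weaken => //; exact: ltW.
Qed.

End descent_field.

(** * Uniform estimates near the compact set, and the global field *)

Section field.
Context (R : realType) (X : normedModType R) (Phi : X -> R) (Psi : X -> \bar R).
Hypothesis PhiC1 : C1_functional Phi.
Hypothesis PsiNy : forall u, (-oo < Psi u)%E.
Hypothesis Psi_convex : convex_functional Psi.
Hypothesis Psi_lsc : lower_semicontinuous Psi.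
Variables (c eps k : R) (A : set X).
Hypothesis eps0 : 0 < eps.
Hypothesis k0 : 0 < k.
Hypothesis A_compact : compact A.

Let I := energy Phi Psi.

(** Compactness of [A] yields one threshold for [rho]; requiring [rho < e / 2] keeps the [rho]-ball
    around a point near [a] inside the neighbourhood of [a]. *)
Lemma near_thickening (P : R -> X -> Prop) :
  (forall a, A a -> \forall u \near a & rho \near 0^'+, P rho u) ->
  \forall rho \near 0^'+, forall a, A a -> forall u, `|u - a| < rho -> P rho u.
Proof.
move=> AP; pose Q rho a := forall u, `|u - a| < rho -> P rho u.
have /compact_near_coveringP/(_ R 0^'+ Q) := A_compact.
apply => a Aa; have [[U V] /= [/near_norm[e e0 eU] V0] UV] := AP a Aa.
have e2 : 0 < e / 2 by lra.
exists ([set a' | `|a' - a| < e / 2], V `&` [set r | r < e / 2]) => /=.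
  split; first by apply/near_norm; exists (e / 2).
  by apply: filterI => //; exact: nbhs_right_lt.
move=> [a' rho] /= [a'a [Vrho rhoe]] u ua'; apply: (UV (u, rho)) => /=.
split => //; apply: eU; have := ler_normD (u - a') (a' - a).
by rewrite addrA subrK; lra.
Qed.

Lemma small_oscillation_near :
  \forall rho \near 0^'+, forall a, A a -> forall u, `|u - a| < rho ->
    small_oscillation Phi k rho u.
Proof.
apply: near_thickening => a Aa; have k8 : 0 < k / 8 by have := k0; lra.
have /near_norm[e e0 eP] := PhiC1.2 a _ k8.
have e2 : 0 < e / 2 by lra.
exists ([set u | `|u - a| < e / 2], [set r | r < e / 2]) => /=.
  by split; [apply/near_norm; exists (e / 2)|exact: nbhs_right_lt].
move=> [u rho] /= [ua rhoe] x xu w.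
have xa : `|x - a| < e.
  by have := ler_normD (x - u) (u - a); rewrite addrA subrK; lra.
have ua' : `|u - a| < e by lra.
have := ler_normD ('d Phi x w - 'd Phi a w) ('d Phi a w - 'd Phi u w).
rewrite addrA subrK (distrC ('d Phi a w)) => tri; apply: le_trans tri _.
apply: le_trans (lerD (eP x xa w) (eP u ua' w)) _.
by rewrite -mulrDl; apply: ler_wpM2r => //; lra.
Qed.

(* [v] is [a] itself when the energy of [a] is low: by lower semicontinuity a
   point near [a] is either of low energy too, or its energy drops by a fixed
   amount on the short way to [a]. *)
Lemma drop_near (a : X) : A a -> (Psi a < +oo)%E ->
  (((c - 2 * eps)%:E < I a)%E -> exists v,
     ((2 * k * `|v - a| + 'd Phi a (v - a))%:E + Psi v < Psi a)%E) ->
  exists v p, Psi v = p%:E /\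
    \forall u \near a & rho \near 0^'+, ((c - 3 / 2 * eps)%:E < I u)%E ->
      ((2 * k * `|v - u| + 'd Phi u (v - u) + p)%:E < Psi u)%E /\
      ((k * rho + 'd Phi u (v - u) + p)%:E < Psi u)%E.
Proof.
move=> Aa Pa slope.
pose F := filter_prod (nbhs a) (0^'+ : set_system R).
have FF : Filter F by exact: filter_prod_filter.
have ua : fst @ F --> a by exact: cvg_fst.
have r0 : snd @ F --> (0 : R).
  by apply: cvg_trans cvg_snd _; exact: cvg_within.
have f1 v p :
    (fun t : X * R => 2 * k * `|v - t.1| + 'd Phi (t.1) (v - t.1) + p) @ F -->
    2 * k * `|v - a| + 'd Phi a (v - a) + p.
  have vt : (fun t : X * R => v - t.1) @ F --> v - a.
    by apply: cvgB => //; exact: cvg_cst.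
  apply: cvgD; last exact: cvg_cst.
  apply: cvgD; last exact: C1_diff_cvg.
  by apply: cvgM; [exact: cvg_cst|exact: cvg_norm].
have f2 v p : (fun t : X * R => k * t.2 + 'd Phi (t.1) (v - t.1) + p) @ F
    --> k * 0 + 'd Phi a (v - a) + p.
  have vt : (fun t : X * R => v - t.1) @ F --> v - a.
    by apply: cvgB => //; exact: cvg_cst.
  apply: cvgD; last exact: cvg_cst.
  apply: cvgD; last exact: C1_diff_cvg.
  by apply: cvgM => //; exact: cvg_cst.
have [Ia|Ia] := ltP (c - 2 * eps)%:E (I a).
  have [v v2] := slope Ia.
  have [p pE] : exists p, Psi v = p%:E.
    have := PsiNy v; move: v2; case: (Psi v) => [p| |]//; first by exists p.
    by rewrite addey// ltNge leey.
  exists v, p; split => //; rewrite pE -EFinD in v2.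
  have v3 : ((k * 0 + 'd Phi a (v - a) + p)%:E < Psi a)%E.
    apply: le_lt_trans v2; rewrite lee_fin lerD2r lerD2r mulr0.
    by rewrite !mulr_ge0// ltW.
  have N1 := lsc_near _ Psi_lsc (f1 v p) ua v2.
  have N2 := lsc_near _ Psi_lsc (f2 v p) ua v3.
  suff : \forall t \near F, ((c - 3 / 2 * eps)%:E < I t.1)%E ->
      ((2 * k * `|v - t.1| + 'd Phi (t.1) (v - t.1) + p)%:E < Psi t.1)%E /\
      ((k * t.2 + 'd Phi (t.1) (v - t.1) + p)%:E < Psi t.1)%E.
    by [].
  by near=> t => _; split; near: t; [exact: N1|exact: N2].
have [p pE] : exists p, Psi a = p%:E.
  by have := PsiNy a; move: Pa; case: (Psi a) => // p; exists p.
exists a, p; split => //.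
have Phit : (fun t : X * R => Phi t.1) @ F --> Phi a.
  exact: (continuous_cvg _ (C1_continuous PhiC1 (x:=a)) ua).
have dPa : p + Phi a < c - 3 / 2 * eps.
  move: Ia; rewrite /I /energy pE -EFinD lee_fin; have := eps0; lra.
have ltI (x : R) (u : X) : x + Phi u < c - 3 / 2 * eps ->
    ((c - 3 / 2 * eps)%:E < I u)%E -> (x%:E < Psi u)%E.
  move=> xu; rewrite /I /energy; have := PsiNy u.
  case: (Psi u) => [q| |]// _; last by move=> _; rewrite ltry.
  by rewrite -EFinD !lte_fin; lra.
have g1 := cvgr_lt _ (cvgD (f1 a p) Phit) (c - 3 / 2 * eps).
have g2 := cvgr_lt _ (cvgD (f2 a p) Phit) (c - 3 / 2 * eps).
rewrite subrr normr0 linear0 !mulr0 !add0r in g1 g2.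
suff : \forall t \near F, ((c - 3 / 2 * eps)%:E < I t.1)%E ->
    ((2 * k * `|a - t.1| + 'd Phi (t.1) (a - t.1) + p)%:E < Psi t.1)%E /\
    ((k * t.2 + 'd Phi (t.1) (a - t.1) + p)%:E < Psi t.1)%E.
  by [].
near=> t => It.
split; apply: ltI => //; near: t; first exact: (g1 FF FF dPa).
exact: (g2 FF FF dPa).
Unshelve. all: by end_near. Qed.

Lemma drop_thickening :
  (forall a, A a -> (Psi a < +oo)%E) ->
  (forall a, A a -> ((c - 2 * eps)%:E < I a)%E -> exists v,
     ((2 * k * `|v - a| + 'd Phi a (v - a))%:E + Psi v < Psi a)%E) ->
  \forall rho \near 0^'+, forall a, A a -> forall u, `|u - a| < rho ->
    ((c - 3 / 2 * eps)%:E < I u)%E -> exists2 v, `|v - u| < rho &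
     ((k * rho + 'd Phi u (v - u))%:E + Psi v < Psi u)%E.
Proof.
move=> Afin slope.
have near1 : \forall rho \near 0^'+, forall a, A a -> forall u, `|u - a| < rho ->
    ((c - 3 / 2 * eps)%:E < I u)%E -> exists v p, [/\ Psi v = p%:E,
      ((2 * k * `|v - u| + 'd Phi u (v - u) + p)%:E < Psi u)%E &
      ((k * rho + 'd Phi u (v - u) + p)%:E < Psi u)%E].
  apply: near_thickening => a Aa.
  have [v [p [pE nP]]] := drop_near Aa (Afin a Aa) (slope a Aa).
  apply: filterS nP => -[u rho] /= uP Iu.
  by exists v, p; split => //; have [] := uP Iu.
near=> rho => a Aa u ua Iu.
have rho0 : 0 < rho by near: rho; exact: nbhs_right_gt.
have : exists v p, [/\ Psi v = p%:E,
      ((2 * k * `|v - u| + 'd Phi u (v - u) + p)%:E < Psi u)%E &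
      ((k * rho + 'd Phi u (v - u) + p)%:E < Psi u)%E].
  by move: a Aa u ua Iu; near: rho.
move=> [v [p [pE v1 v2]]].
have [vu|uv] := ltP `|v - u| rho; first by exists v => //; rewrite pE -EFinD.
(* If [Psi u] is infinite, the nearby point [a], where [Psi] is finite, is a valid target. *)
have := leey (Psi u); rewrite le_eqVlt => /orP[/eqP Pu|Pu].
  exists a; first by rewrite distrC.
  rewrite Pu; have := Afin a Aa; have := PsiNy a.
  by case: (Psi a) => // q _ _; rewrite -EFinD ltry.
have vu0 : 0 < `|v - u| by exact: lt_le_trans uv.
(* The target is pulled back to distance [3/4 rho], where the slope [2 * k] still gives
   [3/2 k rho]. *)
pose t := 3 / 4 * rho / `|v - u|.
have t01 : 0 < t <= 1.
  rewrite /t divr_gt0//=; last by lra.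
  by rewrite ler_pdivrMr// mul1r; lra.
have k2 : 0 <= 2 * k by have := k0; lra.
rewrite EFinD -pE in v1.
have [v' [v't v'2]] := scale_slope PsiNy Psi_convex t01 Pu k2 v1.
rewrite divfK ?gt_eqF// in v't.
exists v'; first by rewrite v't; lra.
apply: le_lt_trans v'2; apply: leeD => //; rewrite lee_fin lerD2r v't.
have : 0 <= k * rho by rewrite mulr_ge0// ltW.
lra.
Unshelve. all: by end_near. Qed.

(** [convex_selection] is applied off the closed low level set within the thickening of [A]; the
    identity is used on the low set. *)
Lemma descent_field_exists (k1 : R) : 0 < k1 ->
  (forall a, A a -> (I a <= (c + eps)%:E)%E) ->
  (forall u a, A a -> `|u - a| < k1 -> ((c - 2 * eps)%:E <= I u)%E ->
    (I u <= (c + eps)%:E)%E -> exists v,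
     ((2 * k * `|v - u| + 'd Phi u (v - u))%:E + Psi v < Psi u)%E) ->
  exists rho, [/\ 0 < rho <= 1 / 2, 4 * (k * rho) <= eps,
    forall a u, A a -> `|u - a| < rho -> small_oscillation Phi k rho u &
    exists V : X -> X, forall a u, A a -> `|u - a| < rho ->
      descent Phi Psi c eps k rho u (V u) /\ {for u, continuous V}].
Proof.
move=> k10 AI slope.
have Afin a : A a -> (Psi a < +oo)%E.
  move=> /AI; rewrite /I /energy; case: (Psi a) => [q| |]//.
  by rewrite ltry.
have slopeA a : A a -> ((c - 2 * eps)%:E < I a)%E -> exists v,
     ((2 * k * `|v - a| + 'd Phi a (v - a))%:E + Psi v < Psi a)%E.
  by move=> Aa Ia; apply: (slope a a Aa) (ltW Ia) (AI a Aa); rewrite subrr normr0.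
pose good rho := [/\ 0 < rho <= 1 / 2, 4 * (k * rho) <= eps, rho <= k1,
   forall a, A a -> forall u, `|u - a| < rho -> small_oscillation Phi k rho u &
   forall a, A a -> forall u, `|u - a| < rho ->
    ((c - 3 / 2 * eps)%:E < I u)%E -> exists2 v, `|v - u| < rho &
     ((k * rho + 'd Phi u (v - u))%:E + Psi v < Psi u)%E].
have [rho [rho12 krho rhok osc drop]] : exists rho, good rho.
  suff : \forall rho \near 0^'+, good rho by apply: filter_ex.
  near=> rho; have rho0 : 0 < rho by near: rho; exact: nbhs_right_gt.
  split.
  - apply/andP; split => //; near: rho; apply: nbhs_right_le; lra.
  - have : rho <= eps / (4 * k).
      by near: rho; apply: nbhs_right_le; rewrite divr_gt0// mulr_gt0.
    by rewrite ler_pdivlMr ?mulr_gt0// => h; rewrite mulrA mulrC.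
  - by near: rho; exact: nbhs_right_le.
  - by near: rho; exact: small_oscillation_near.
  - by near: rho; exact: drop_thickening.
have /andP[rho0 rho1] := rho12.
exists rho; split => //; first by move=> a u Aa; exact: osc.
pose O := [set u | exists2 a, A a & `|u - a| < rho].
have Onear u : O u -> \forall z \near u, O z.
  move=> [a Aa ua]; apply/near_norm; exists (rho - `|u - a|).
    by rewrite subr_gt0.
  move=> z zu; exists a => //; have := ler_normD (z - u) (u - a).
  by rewrite addrA subrK; lra.
pose lo := low_level Phi Psi c eps.
pose D := descent Phi Psi c eps k rho.
have lonear u : ~ lo u -> \forall z \near u, ~ lo z.
  move=> lu; have [e e0 eP] := low_far PhiC1 Psi_lsc lu.
  by apply/near_norm; exists e => // z zu /eP; rewrite leNgt zu.
have [|u [[a Aa ua] lou]|V0 V0P] :=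
    @convex_selection _ _ _ [set u | O u /\ ~ lo u] D.
- by move=> u _; apply: descent_convex => //; exact: ltW.
- have [|v vP] := descent_exists PhiC1 PsiNy Psi_convex Psi_lsc eps0 k0 rho0
    krho lou (osc a Aa u ua) (drop a Aa u ua).
    move=> Iu; apply: (slope u a Aa).
    + exact: lt_le_trans ua rhok.
    + by apply/ltW; rewrite ltNge; exact/negP.
    + by apply: le_trans Iu _; rewrite lee_fin; have := eps0; lra.
  exists v; have Ou : O u by exists a.
  by apply: filterS3 (Onear u Ou) (lonear u lou) vP.
pose V u := if pselect (lo u) then u else V0 u.
have loV u : lo u -> V u = u by rewrite /V; case: pselect.
have nloV u : ~ lo u -> V u = V0 u by rewrite /V; case: pselect.
have VD u : O u -> D u (V u).
  move=> Ou; have [lou|lou] := pselect (lo u); last first.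
    by rewrite nloV//; have [] := V0P u (conj Ou lou).
  rewrite loV//; split.
  - by rewrite subrr normr0 ltW.
  - by move=> w _; rewrite subrr normr0 mulr_ge0.
  - by rewrite subrr normr0 linear0 mulr0 addr0 add0e.
  - have lu : (energy Phi Psi u <= (c - 2 * eps)%:E)%E := lou.
    move=> Iu; exfalso; have := le_trans Iu lu; rewrite lee_fin.
    by have := eps0; lra.
exists V => a u Aa ua; have Ou : O u by exists a.
split; first exact: VD.
have [lou|lou] := pselect (lo u); last first.
  apply: (@near_eq_continuous _ _ V0); last by have [] := V0P u (conj Ou lou).
  by apply: filterS (lonear u lou) => z lz; rewrite nloV.
apply/cvgrPdist_lt => /= e e0.
have e3 : 0 < e / 3 by lra.
have zu : \forall z \near u, `|z - u| < e / 3 by apply/near_norm; exists (e / 3).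
apply: filterS2 (Onear u Ou) zu => z Oz zu.
(* Continuity at a low point [u]: comparison with [w = u] gives [|V z - z| <= 2 * |u - z|], hence
   [|V z - u| <= 3 * |z - u|]. *)
have [_ /(_ u lou) Vz _ _] := VD z Oz.
rewrite loV// distrC; have := ler_normD (V z - z) (z - u).
rewrite addrA subrK; rewrite (distrC u) in Vz; lra.
Unshelve. all: by end_near. Qed.

End field.

(** * Equivariance *)

Section equivariance.
Context (R : realType) (X : completeNormedModType R) (G : topologicalGroupType)
  (mu : probability (borel G) R) (act : G -> X -> X).
Hypothesis G_compact : compact [set: G].
Hypothesis mu_haar : normalized_haar mu.
Hypothesis act_action : linear_action act.
Hypothesis act_isometric : isometric act.

Lemma action_linear_map (g : G) :
  exists2 L : {linear X -> X}, (L : X -> X) = act g & continuous L.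
Proof.
pose L : {linear X -> X} :=
  HB.pack (act g) (GRing.isLinear.Build R X X *:%R (act g)
    (act_linear act_action g)).
exists L => // x; apply: (@continuous_comp _ _ _ (fun x : X => (g, x))
  (fun p : G * X => act p.1 p.2)); last exact: act_continuous.
by apply: cvg_pair => /=; [exact: cvg_cst|exact: cvg_id].
Qed.

Lemma actVK (g : G) (x : X) : act g (act g^-1%g x) = x.
Proof. by rewrite -(actM act_action) mulgV (act1 act_action). Qed.

Lemma norm_actB (g : G) (x y : X) : `|act g x - act g y| = `|x - y|.
Proof.
have [L LE _] := action_linear_map g; have := linearB L x y.
by rewrite LE => <-.
Qed.

(* The average of [g V(g^-1 u)] over [g] depends equivariantly on [u], and it
   stays in the closed convex set [D u] since [D] is invariant. *)
Lemma equivariant_average (O : set X) (D : X -> set X) (V : X -> X) :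
  open O -> (forall g u, O u -> O (act g u)) ->
  (forall u, convex_in (D u)) -> (forall u, closed (D u)) ->
  (forall g u v, D u v -> D (act g u) (act g v)) ->
  (forall u, O u -> D u (V u) /\ {for u, continuous V}) ->
  exists V' : X -> X, forall u, O u -> [/\ D u (V' u), {for u, continuous V'} &
    forall g, V' (act g u) = act g (V' u)].
Proof.
move=> Oo Oact Dc Dcl Dact VP.
pose f (p : G * X) := act p.1 (V (act p.1^-1%g p.2)).
have fc g u : O u -> {for (g, u), continuous f}.
  move=> Ou.
  have c1 : {for (g, u), continuous (fun p : G * X => act p.1^-1%g p.2)}.
    apply: (@continuous_comp _ _ _ (fun p : G * X => (p.1^-1%g, p.2))
      (fun p : G * X => act p.1 p.2)); last exact: act_continuous.
    apply: cvg_pair => /=; last exact: cvg_snd.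
    by apply: (cvg_comp _ _ cvg_fst); exact: invg_continuous.
  have c2 : {for (g, u), continuous (fun p : G * X => V (act p.1^-1%g p.2))}.
    apply: (@continuous_comp _ _ _ (fun p : G * X => act p.1^-1%g p.2) V) => //.
    by have [] := VP _ (Oact g^-1%g _ Ou).
  apply: (@continuous_comp _ _ _ (fun p : G * X => (p.1, V (act p.1^-1%g p.2)))
    (fun p : G * X => act p.1 p.2)); last exact: act_continuous.
  by apply: cvg_pair => //=; exact: cvg_fst.
pose F u g := f (g, u).
have /choice[V' V'P] (u : X) : exists y, O u ->
    is_average mu (F u : borel G -> X) y.
  have [Ou|] := pselect (O u); last by exists 0.
  have [|y yP] := @average_ex R X G mu G_compact (F u); last by exists y.
  move=> g; apply: (@continuous_comp _ _ _ (fun g : G => (g, u)) f).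
    by apply: cvg_pair => /=; [exact: cvg_id|exact: cvg_cst].
  exact: fc.
exists V' => u Ou; split.
- apply: (is_average_closed (Dc u) (Dcl u) _ (V'P u Ou)) => _ [g _ <-].
  rewrite /F /f /= -{1}(actVK g u); apply: Dact.
  by have [] := VP _ (Oact g^-1%g _ Ou).
(* Compactness of [G] makes [F u'] uniformly close to [F u] over the group, and averages inherit the
   bound. *)
- apply/cvgrPdist_le => /= e e0.
  have e2 : 0 < e / 2 by lra.
  have uF : \forall u' \near u, [set: G] `<=` [set g | `|F u g - F u' g| <= e].
    have /compact_near_coveringP/(_ X (nbhs u)
      (fun u' g => `|F u g - F u' g| <= e)) := G_compact.
    apply => g _; have /cvgrPdist_lt/(_ _ e2) := fc g u Ou.
    move=> [[B C] /= [gB uC] BC]; exists (B, C) => //= -[g' u'] /= [Bg' Cu'].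
    have h1 : `|f (g, u) - f (g', u)| < e / 2.
      by apply: (BC (g', u)); split => //; exact: nbhs_singleton.
    have h2 : `|f (g, u) - f (g', u')| < e / 2 by exact: (BC (g', u')).
    have := ler_normD (f (g', u) - f (g, u)) (f (g, u) - f (g', u')).
    by rewrite addrA subrK (distrC (f (g', u)) (f (g, u))) /F; lra.
  have uO : \forall u' \near u, O u' by exact: open_nbhs_nbhs.
  apply: filterS2 uF uO => u' uF Ou'.
  by apply: is_average_dist (V'P u Ou) (V'P u' Ou') => g; exact: uF.
(* [F (act h u)] at [g] is [act h] of [F u] at [h^-1 * g]; left invariance and uniqueness of
   averages conclude. *)
- move=> h; have [L LE _] := action_linear_map h.
  have avu := average_left_invariant h^-1%g mu_haar (V'P u Ou).
  have Liso x : `|L x| = `|x| by rewrite LE.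
  have := is_average_isometry Liso avu; rewrite LE => avL.
  apply: is_average_unique (V'P _ (Oact h u Ou)) _.
  rewrite [F _](_ : _ = act h \o (fun g => F u (h^-1 * g)%g))//.
  apply/funext => g /=; rewrite /F /f /= -!(actM act_action) mulVKg.
  by rewrite invgM invgK.
Qed.

Lemma descent_act (Phi : X -> R) (Psi : X -> \bar R) (c eps k rho : R)
    (g : G) (u v : X) : C1_functional Phi ->
  invariant_fun act Phi -> invariant_fun act Psi ->
  descent Phi Psi c eps k rho u v ->
  descent Phi Psi c eps k rho (act g u) (act g v).
Proof.
move=> PhiC1 Phig Psig [v1 v2 v3 v4].
have dE : 'd Phi (act g u) (act g v - act g u) = 'd Phi u (v - u).
  have [L LE Lc] := action_linear_map g; have := linearB L v u.
  rewrite -LE => <-.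
  by apply: diff_invariant => // x; rewrite LE.
have IE h w : energy Phi Psi (act h w) = energy Phi Psi w.
  by rewrite /energy Phig Psig.
split; rewrite ?IE ?norm_actB ?dE ?Psig//.
(* The low level set is invariant, so [w] is pulled back by [g^-1]. *)
move=> w lw; rewrite -(actVK g w) norm_actB; apply: v2.
by rewrite /low_level /= IE.
Qed.

End equivariance.

(** * Construction of the deformation *)

Lemma sube_le (R : realType) (x y : \bar R) (r : R) :
  (-oo < y)%E -> (x <= y - r%:E)%E -> (x - y <= (- r)%:E)%E.
Proof.
(* For [y = +oo] the difference is [-oo], so points of infinite energy satisfy every bound. *)
case: y => [y| |]//; last by move=> _ _; rewrite addeNy leNye.
by move=> _ xy; rewrite leeBlDl// EFinN.
Qed.

Theorem lemma3p4 (R : realType) (X : completeNormedModType R)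
    (G : topologicalGroupType) (mu : probability (borel G) R)
    (act : G -> X -> X) (Phi : X -> R) (Psi : X -> \bar R) :
  compact [set: G] ->
  normalized_haar mu ->
  linear_action act ->
  isometric act ->
  C1_functional Phi ->
  (forall u, (-oo < Psi u)%E) ->
  convex_functional Psi ->
  lower_semicontinuous Psi ->
  (exists u, Psi u != +oo%E) ->
  palais_smale Phi Psi ->
  invariant_fun act Phi ->
  invariant_fun act Psi ->
  compatible act mu Psi ->
  let I := energy Phi Psi in
  let K := critical Phi Psi in
  forall (c : R) (N : set X) (eps0 : R),
  critical_level Phi Psi c `<=` N° ->
  0 < eps0 ->
  exists eps : R, [/\ 0 < eps, eps < eps0 &
  forall delta0 : R, 0 < delta0 ->
  exists delta : R, [/\ 0 < delta, delta < delta0 &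
  forall A : set X, compact A -> A `<=` ~` N ->
    (c%:E <= ereal_sup (I @` A))%E ->
    (ereal_sup (I @` A) <= (c + eps)%:E)%E ->
  exists (W : set X) (s0 : R) (alpha : R -> X -> X),
    [/\ closed W, A `<=` W°, 0 < s0, deformation W s0 alpha &
    (forall s : R, 0 <= s <= s0 ->
      [/\ (* i *) (forall u, W u -> `|alpha s u - u| <= s),
          (* ii *)
          (forall u, W u -> (I (alpha s u) - I u <= (s + delta * s)%:E)%E) /\
          (forall u, W u -> ((c - eps)%:E <= I u)%E ->
            (I (alpha s u) - I u <= (- (3 * eps * s) + delta * s)%:E)%E),
          (* iii *)
          (forall u, W u -> (I (alpha s u) - I u <= (2 * s)%:E)%E),
          (* iv *)
          (forall u, W u -> ((c - eps)%:E <= I u)%E ->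
            (I (alpha s u) - I u <= (- (2 * eps * s))%:E)%E) &
          (* v *)
          (ereal_sup [set I (alpha s u) | u in A] - ereal_sup (I @` A)
             <= (- (2 * eps * s))%:E)%E /\
          (* vi *)
          (forall C : set X, closed C -> C `&` K = set0 ->
            forall u, (W `&` C) u -> (I (alpha s u) - I u <= 0)%E)]) /\
    (invariant_set act A ->
      forall s : R, 0 <= s <= s0 -> forall g u, A u ->
        alpha s (act g u) = act g (alpha s u))]]].
Proof.
move=> G_compact mu_haar act_action act_iso PhiC1 PsiNy Psi_convex Psi_lsc _ PS.
move=> Phig Psig _ I K c N eps0 KN eps0_gt0.
have [k1 k10 slope] := palais_smale_slope PhiC1 PsiNy Psi_lsc PS KN.
(* [2 * k] is the slope [k1]; [eps <= k1 / 8] keeps the levels between [c - 2 * eps] and [c + eps]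
   in the range of [slope] and gives [3 * eps <= 3/4 k], the rate in [descent_energy]. *)
pose k := k1 / 2; pose eps := Num.min (eps0 / 2) (k1 / 8).
have k0 : 0 < k by rewrite /k; lra.
have [eps_lt eps_k1] : eps <= eps0 / 2 /\ eps <= k1 / 8.
  by split; rewrite ge_min lexx ?orbT.
have eps_gt0 : 0 < eps by rewrite lt_min; apply/andP; split; lra.
exists eps; split; [exact: eps_gt0|lra|] => delta0 delta0_gt0.
exists (delta0 / 2); split; [lra|lra|] => A A_compact AN cA Ac.
have AI a : A a -> (I a <= (c + eps)%:E)%E.
  by move=> Aa; apply: le_trans Ac; apply: ereal_sup_ubound; exists a.
have slopeA u a : A a -> `|u - a| < k1 -> ((c - 2 * eps)%:E <= I u)%E ->
    (I u <= (c + eps)%:E)%E -> exists v,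
    ((2 * k * `|v - u| + 'd Phi u (v - u))%:E + Psi v < Psi u)%E.
  move=> /AN Na ua Iu1 Iu2; have -> : 2 * k = k1 by rewrite /k; lra.
  apply: (slope u a) => //.
    by apply: le_trans Iu1; rewrite lee_fin; lra.
  by apply: le_trans Iu2 _; rewrite lee_fin; lra.
have [rho [/andP[rho0 rho1] krho osc [V0 V0P]]] := descent_field_exists PhiC1 PsiNy
  Psi_convex Psi_lsc eps_gt0 k0 A_compact k10 AI slopeA.
pose D := descent Phi Psi c eps k rho.
pose O := [set u | exists2 a, A a & `|u - a| < rho].
have Oo : open O.
  rewrite openE => u [a Aa ua]; apply/near_norm; exists (rho - `|u - a|).
    by rewrite subr_gt0.
  move=> z zu; exists a => //; have := ler_normD (z - u) (u - a).
  by rewrite addrA subrK; lra.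
have [V [VP Vact]] : exists V : X -> X,
    (forall u, O u -> D u (V u) /\ {for u, continuous V}) /\
    (invariant_set act A -> forall g u, O u -> V (act g u) = act g (V u)).
  have V0P' u : O u -> D u (V0 u) /\ {for u, continuous V0}.
    by move=> [a Aa ua]; exact: (V0P a).
  have [Ainv|] := pselect (invariant_set act A); last by exists V0.
  have [||||V VP] := equivariant_average G_compact mu_haar act_action act_iso
    Oo (D := D) _ _ _ _ V0P'.
  - move=> g u [a Aa ua]; exists (act g a); first by rewrite -(Ainv g); exists a.
    by rewrite norm_actB.
  - by move=> u; apply: descent_convex => //; exact: ltW.
  - by move=> u; exact: descent_closed.
  - by move=> g u v; exact: descent_act.
  exists V; split=> [u /VP[]//|_ g u /VP[_ _]]; exact.
(* Half the radius keeps the closure inside [O], where [V] is continuous. *)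
pose W := closure [set u | exists2 a, A a & `|u - a| < rho / 2].
have WO : W `<=` O.
  move=> u uW; have rho2 : 0 < rho / 2 by lra.
  have := uW [set z | `|z - u| < rho / 2].
  case; first by apply/near_norm; exists (rho / 2).
  move=> z [[a Aa za] zu]; exists a => //.
  have {}zu : `|z - u| < rho / 2 := zu.
  have := ler_normD (u - z) (z - a); rewrite addrA subrK (distrC u z); lra.
have AW : A `<=` W.
  by move=> a Aa; apply: subset_closure; exists a; rewrite // subrr normr0; lra.
(* Since [|V u - u| <= rho], dividing by [rho] makes the displacement at most [s]. *)
pose alpha (s : R) u := u + (s / rho) *: (V u - u).
have main s u : 0 <= s <= rho -> W u -> [/\ `|alpha s u - u| <= s,
    (I (alpha s u) <= I u)%E & ((c - eps)%:E <= I u)%E ->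
    (I (alpha s u) <= I u - (3 * eps * s)%:E)%E].
  move=> /andP[s0 s1] /WO Ou; have [Du _] := VP _ Ou.
  have t01 : 0 <= s / rho <= 1.
    by rewrite divr_ge0 ?(ltW rho0)//= ler_pdivrMr// mul1r.
  have sE : s / rho * rho = s by rewrite divfK// gt_eqF.
  have oscu : small_oscillation Phi k rho u.
    by have [a Aa ua] := Ou; exact: osc ua.
  have [Iu1 Iu2] := descent_energy PhiC1 PsiNy Psi_convex k0
    oscu Du t01.
  split => //.
  - have /andP[t0 _] := t01; have [Vu _ _ _] := Du.
    rewrite /alpha addrAC subrr add0r normrZ ger0_norm// -{2}sE.
    exact: ler_wpM2l.
  - move=> /Iu2 Iu; apply: le_trans Iu _; apply: leeB => //; rewrite lee_fin.
    have -> : 3 / 4 * (s / rho) * (k * rho) = 3 / 4 * k * (s / rho * rho).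
      by ring.
    by rewrite sE ler_wpM2r//; rewrite /k; lra.
have INy u : (-oo < I u)%E.
  have := PsiNy u; rewrite /I /energy; case: (Psi u) => [q| |]// _.
  by rewrite ltNyr.
have drop0 s u r : 0 <= s <= rho -> W u -> 0 <= r ->
    (I (alpha s u) - I u <= r%:E)%E.
  move=> s01 Wu r0; have [_ Iu _] := main s u s01 Wu.
  rewrite -[r]opprK; apply: sube_le; first exact: INy.
  apply: le_trans Iu _; rewrite EFinN oppeK leeDl// lee_fin//.
have drop3 s u r : 0 <= s <= rho -> W u -> ((c - eps)%:E <= I u)%E ->
    r <= 3 * eps * s -> (I (alpha s u) - I u <= (- r)%:E)%E.
  move=> s01 Wu cu r3; have [_ _ /(_ cu) Iu] := main s u s01 Wu.
  apply: sube_le; first exact: INy.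
  by apply: le_trans Iu _; apply: leeB.
exists W, rho, alpha; split => //.
- exact: closed_closure.
- move=> a Aa; apply/near_norm; exists (rho / 2); first by lra.
  by move=> z za; apply: subset_closure; exists a.
- split; last by move=> u _; rewrite /alpha mul0r scale0r addr0.
  apply: continuous_in_subspaceT => -[s u] /set_mem[_ /= /WO Ou].
  have [_ Vc] := VP _ Ou.
  have c2 : {for (s, u), continuous (fun p : R * X => p.2)} by exact: cvg_snd.
  have cV : {for (s, u), continuous (fun p : R * X => V p.2)}.
    exact: (@continuous_comp _ _ _ (fun p : R * X => p.2) V).
  apply: cvgD; first exact: c2.
  apply: cvgZ; last exact: (cvgB cV c2).
  by apply: cvgM; [exact: cvg_fst|exact: cvg_cst].
split; last first.
  move=> Ainv s s01 g u Au; have [L LE _] := action_linear_map act_action g.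
  have Ou : O u by apply: WO; exact: AW.
  rewrite /alpha Vact// addrC [in RHS]addrC.
  have := act_linear act_action g (s / rho) (V u - u) u => ->.
  by congr (_ *: _ + _); rewrite -LE linearB.
move=> s s01; have /andP[s0 s1] := s01.
have eps_s : 0 <= eps * s by rewrite mulr_ge0// ltW.
have ds : 0 <= delta0 / 2 * s by rewrite mulr_ge0//; lra.
split.
- by move=> u Wu; have [] := main s u s01 Wu.
- split=> u Wu; first by apply: drop0 => //; lra.
  move=> cu; have := drop3 s u (3 * eps * s) s01 Wu cu (lexx _) => h.
  by apply: le_trans h _; rewrite lee_fin; lra.
- by move=> u Wu; apply: drop0 => //; lra.
- by move=> u Wu cu; apply: drop3 => //; lra.
split; last first.
  by move=> C _ _ u [Wu _]; exact: drop0.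
set S := ereal_sup (I @` A) in cA Ac *.
have Sfin : S \is a fin_num.
  rewrite fin_numE; apply/andP; split; apply/eqP => SE.
    by move: cA; rewrite SE.
  by move: Ac; rewrite SE.
apply: sube_le; first by apply: lt_le_trans cA; rewrite ltNyr.
apply: ge_ereal_sup => _ [u Au <-].
have Wu := AW _ Au.
have IuS : (I u <= S)%E by apply: ereal_sup_ubound; exists u.
have [_ Iu1 Iu2] := main s u s01 Wu.
(* Points at level at least [c - eps] drop by [3 * eps * s]. The others stay below
   [c - eps <= S - eps], which suffices because [s <= rho <= 1 / 2]. *)
have [cu|cu] := leP (c - eps)%:E (I u).
  by apply: le_trans (Iu2 cu) _; apply: leeB => //; rewrite lee_fin; lra.
apply: le_trans Iu1 _; apply: le_trans (ltW cu) _.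
move: cA; rewrite -(fineK Sfin) lee_fin => cA.
rewrite -EFinB lee_fin.
have : eps * s <= eps * (1 / 2).
  by apply: ler_wpM2l; [exact: ltW|exact: le_trans s1 rho1].
by lra.
Qed.
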